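(* For every $M\in\mathbb N$, $\overline{\overline d}=0$, where $\overline{\overline d}=\frac1{M+1}\sum_{T=0}^M\overline d(T,M+1)$.
   Context: Fix integers $M\ge1$, $q\ge2$. The augmented state set is $\overline S=\{(b_1,\dots,b_M,d;T,t): b_m,d,T\in\mathbb Z,\ 1\le t\le M+1,\ d+T+\sum_{m=1}^M b_m=0\}$, the BDM state set is $S=\{s\in\overline S:0\le T\le M\}$, $S(T_0,t_0)=\{s\in S:T=T_0,t=t_0\}$; initial state $s_0=(0,\dots,0,0;0,M+1)$; $d(s)$ denotes the $d$-coordinate of $s$. The BDM is the Markov chain on $S$ with transitions from $s=(b_1,\dots,b_M,d;T,t)$: if $t\le M$ and $b_t>d$, with probability $(q-1)/q$ to $(b_1,\dots,b_{t-1},d,b_{t+1},\dots,b_M,b_t;T,t+1)$ and with probability $1/q$ to $(b_1,\dots,b_M,d;T,t+1)$; if $t\le M$ and $b_t\le d$, with probability 1 to $(b_1,\dots,b_M,d;T,t+1)$; if $t=M+1,T<M$, with probability 1 to $(b_1,\dots,b_M,d-1;T+1,1)$; if $t=M+1,T=M$, with probability 1 to $(b_1+1,\dots,b_M+1,d;0,1)$. Let $\mu_0$ be the point mass at $s_0$, $\mu_{\tau+1}(s')=\sum_s\mu_\tau(s)p(s,s')$, and $\mu_\infty(s)=\limsup_{\tau\to\infty}\mu_\tau(s)$. Define $\overline d(T,t)=\sum_{s\in S(T,t)}\mu_\infty(s)\,d(s)$. *)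

(* Defs.v *)
From HB Require Import structures.
From mathcomp Require Import all_boot all_order all_algebra.
From mathcomp Require Import all_classical all_reals all_analysis.
Set Implicit Arguments. Unset Strict Implicit. Unset Printing Implicit Defensive.
Import Order.TTheory GRing.Theory Num.Theory.
Local Open Scope ring_scope.
Local Open Scope classical_set_scope.

(* A state (b_1..b_M, d; T, t) is encoded as ((b, d, T), t) with
   b : seq int (b_m = nth 0 b (m-1)), d T : int, t : nat. *)
Definition state := (seq int * int * int * nat)%type.
Definition sb (s : state) : seq int := s.1.1.1.
Definition sd (s : state) : int := s.1.1.2.
Definition sT (s : state) : int := s.1.2.
Definition st (s : state) : nat := s.2.

Definition inSbar (M : nat) (s : state) : bool :=
  [&& size (sb s) == M, (1 <= st s)%N, (st s <= M.+1)%N &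
      sd s + sT s + \sum_(x <- sb s) x == 0].

Definition inS (M : nat) (s : state) : bool :=
  [&& inSbar M s, 0 <= sT s & sT s <= M%:Z].

Definition S_set (M : nat) : set state := [set s | inS M s].

Definition S_Tt (M : nat) (T0 : int) (t0 : nat) : set state :=
  [set s | [&& inS M s, sT s == T0 & st s == t0]].

Definition s0 (M : nat) : state := (nseq M 0, 0, 0, M.+1).

Definition step (R : realType) (M q : nat) (s : state) : seq (state * R) :=
  let b := sb s in let d := sd s in let T := sT s in let t := st s in
  if (t <= M)%N then
    let bt := nth 0 b t.-1 in
    if d < bt then
      [:: ((set_nth 0 b t.-1 d, bt, T, t.+1), (q%:R - 1) / q%:R);
          ((b, d, T, t.+1), 1 / q%:R)]
    else [:: ((b, d, T, t.+1), 1)]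
  else if T < M%:Z then [:: ((b, d - 1, T + 1, 1%N), 1)]
  else [:: ((map (fun x => x + 1) b, d, 0, 1%N), 1)].

Definition p (R : realType) (M q : nat) (s s' : state) : R :=
  \sum_(x <- step R M q s | x.1 == s') x.2.

Fixpoint mu (R : realType) (M q : nat) (tau : nat) (s' : state) : \bar R :=
  match tau with
  | 0%N => if s' == s0 M then 1%E else 0%E
  | tau'.+1 => \esum_(s in S_set M) (mu R M q tau' s * (p R M q s s')%:E)%E
  end.

Definition mu_inf (R : realType) (M q : nat) (s : state) : \bar R :=
  limn_esup (fun tau => mu R M q tau s).

Definition dbar (R : realType) (M q : nat) (T : int) (t : nat) : \bar R :=
  let f := fun s => (mu_inf R M q s * (sd s)%:~R%:E)%E in
  (\esum_(s in S_Tt M T t) f^\+ s - \esum_(s in S_Tt M T t) f^\- s)%E.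

Definition dbarbar (R : realType) (M q : nat) : \bar R :=
  ((M.+1%:R)^-1%:E * \sum_(0 <= T < M.+1) dbar R M q T%:Z M.+1)%E.

(* Main.v *)
(* Put lev x = (M+1) x + T for x among b_1, ..., b_M, d; these M+1 levels sum to
   0. One round (M+1 transitions) raises the level of every battery by 1, lowers
   that of d by M, and then only permutes the levels. Hence, with Q the sum of
   the squared levels, the increment of Q over a full period (M+1 rounds) is, on
   every path, - 2 (M+1)^2 times the sum over T of the values of d at t = M+1.
   If the laws along the periods converge together with the expectation of Q,
   the expected increment tends to 0, and so does the expected sum of the d.

   The convergence is Harris' theorem in the form of Hairer and Mattingly. The
   Lyapunov function is the sum of A ^ lev over the batteries plus c A ^ lev(d),
   with c < 1 < A both close to 1: swaps bring the large levels to d, where they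
   weigh less. The minorization comes from the path that swaps whenever it can:
   there d is the maximum of all levels, so Q decreases until s_0 is reached. *)
Require Import Defs.
From HB Require Import structures.
From mathcomp Require Import all_boot all_order all_algebra.
From mathcomp Require Import all_classical all_reals all_analysis.
From mathcomp Require Import ring lra zify.
Import Order.TTheory GRing.Theory Num.Theory numFieldNormedType.Exports.
Local Open Scope ring_scope.
Set Implicit Arguments. Unset Strict Implicit. Unset Printing Implicit Defensive.

(** * Harris' theorem for Markov operators *)

Section markov_operator.
Variables (R : realType) (X : eqType).
Implicit Types (J : X -> Prop) (P : (X -> R) -> X -> R) (f g V : X -> R).

(** A Markov kernel is represented by its action on functions. Monotonicity relative to [J]
    expresses that [J] is closed under the dynamics: on [J], [P f] depends only on the values of [f]
    on [J]. *)
Record markov_op J P : Prop := MarkovOp {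
  mo_lin : forall a f g x,
    P (fun y => a * f y + g y) x = a * P f x + P g x;
  mo_cst : forall c x, P (fun=> c) x = c;
  mo_le : forall f g, (forall y, J y -> f y <= g y) ->
    forall x, J x -> P f x <= P g x }.

Variables (J : X -> Prop) (P : (X -> R) -> X -> R).
Hypothesis PJ : markov_op J P.

Lemma mo_affine a c f x : P (fun y => a * f y + c) x = a * P f x + c.
Proof. by rewrite (mo_lin PJ a f (fun=> c)) (mo_cst PJ). Qed.

Lemma markov_op_iter n : markov_op J (iter n P).
Proof.
split.
- elim: n => [//|n IH] a f g x /=.
  rewrite -(mo_lin PJ); congr (P _ x); apply/funext => y; exact: IH.
- elim: n => [//|n IH] c x /=.
  by rewrite -[RHS](mo_cst PJ c x); congr (P _ x); apply/funext => y; exact: IH.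
- move=> f g fg; elim: n => [//|n IH] x Jx /=; exact: (mo_le PJ).
Qed.

(** The additive errors form a geometric series; [K / (1 - gam)] is the fixed point of v -> gam v +
    K. The bound is uniform in [n]. *)
Lemma drift_iter V (gam K : R) n : 0 <= gam -> gam < 1 -> 0 <= K ->
  (forall x, J x -> P V x <= gam * V x + K) ->
  forall x, J x -> iter n P V x <= gam ^+ n * V x + K / (1 - gam).
Proof.
move=> g0 g1 K0 PV; elim: n => [|n IH] x Jx.
  by rewrite expr0 mul1r lerDl divr_ge0// subr_ge0 ltW.
have g1' : 1 - gam != 0 by rewrite subr_eq0 eq_sym lt_eqF.
rewrite iterSr; apply: le_trans (_ : iter n P (fun y => gam * V y + K) x <= _).
  exact: (mo_le (markov_op_iter n)).
have -> : iter n P (fun y => gam * V y + K) x = gam * iter n P V x + K.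
  rewrite (mo_lin (markov_op_iter n) gam V (fun=> K)).
  by rewrite (mo_cst (markov_op_iter n)).
apply: le_trans (_ : gam * (gam ^+ n * V x + K / (1 - gam)) + K <= _).
  by rewrite lerD2r ler_wpM2l// IH.
by rewrite exprS le_eqVlt; apply/orP; left; apply/eqP; field.
Qed.

(* Hairer-Mattingly: run two copies independently; when [V x + V y] is large
   the drift contracts the weight, otherwise both copies sit at [z]
   simultaneously with probability at least [eps ^+ 2]. *)
Lemma weighted_contraction V (gam K eps : R) (z : X) :
  0 <= gam -> gam < 1 -> 0 <= K -> 0 < eps ->
  (forall x, J x -> 0 <= V x) ->
  (forall x, J x -> P V x <= gam * V x + K) ->
  (forall x, J x -> V x <= (4 * K + 2) / (1 - gam) ->
     eps <= P (fun y => (y == z)%:R) x) ->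
  exists al be : R, [/\ 0 <= al, al < 1, 0 < be &
    forall f C, 0 <= C ->
    (forall x y, J x -> J y -> f x - f y <= C * (1 + be * V x + be * V y)) ->
    forall x y, J x -> J y ->
      P f x - P f y <= al * C * (1 + be * V x + be * V y)].
Proof.
move=> g0 g1 K0 e0 V0 PV Pz.
(* With this weight the drift error 2 K be costs at most half of eps^2. *)
pose be := eps ^+ 2 / (4 * K + 1).
have be0 : 0 < be by rewrite divr_gt0 ?exprn_gt0//; lra.
have beK : 4 * K * be <= eps ^+ 2.
  rewrite /be mulrCA ler_piMr ?sqr_ge0// ler_pdivrMr ?mul1r; lra.
(* The first two entries handle pairs with [V x + V y] large; the third is what the remaining pairs
   add. *)
pose al := Num.max ((1 + gam) / 2) (Num.max (1 - be) (1 - eps ^+ 2 / 2)).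
have al1 : (1 + gam) / 2 <= al by rewrite /al le_max lexx.
have al2 : 1 - be <= al by rewrite /al !le_max lexx orbT.
have al3 : 1 - eps ^+ 2 / 2 <= al by rewrite /al !le_max lexx !orbT.
exists al, be; split => //; first lra.
  by rewrite /al !gt_max; have := exprn_gt0 2 e0 => ?; apply/andP; split; [|apply/andP; split]; lra.
move=> f C C0 fC x y Jx Jy.
set I := fun y : X => (y == z)%:R : R.
have I01 u : 0 <= I u <= 1 by rewrite /I; case: (u == z); rewrite ?lexx ?ler01.
have coupling : P f x - P f y <=
    C * (1 + be * P V x + be * P V y) - C * P I x * P I y.
  (* The two kernels act one variable at a time, first on [v] with [u] fixed. At u = v = z the
     difference of values is 0, which leaves room to subtract [C]. *)
  have H u : J u -> f u - P f y <= C * (1 + be * V u + be * P V y) - C * I u * P I y.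
    move=> Ju.
    have -> : f u - P f y = P (fun v => -1 * f v + f u) y by rewrite mo_affine; ring.
    have -> : C * (1 + be * V u + be * P V y) - C * I u * P I y =
        P (fun v => C * be * V v + (- (C * I u) * I v + C * (1 + be * V u))) y.
      by rewrite (mo_lin PJ (C * be) V) mo_affine; ring.
    apply: (mo_le PJ) => // v Jv.
    have [] := boolP ((u == z) && (v == z)) => [/andP[/eqP uz /eqP vz]|nz].
      have Jz : J z by rewrite -vz.
      have Iz : I z = 1 by rewrite /I eqxx.
      rewrite uz vz Iz.
      have := mulr_ge0 (mulr_ge0 C0 (ltW be0)) (V0 _ Jz); lra.
    have -> : - (C * I u) * I v = 0.
      by move: nz; rewrite /I -mulNr -mulrA -natrM mulnb => /negbTE ->; rewrite mulr0.
    rewrite addrC; have := fC u v Ju Jv; lra.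
  have -> : P f x - P f y = P (fun u => 1 * f u + (- P f y)) x by rewrite mo_affine; ring.
  have -> : C * (1 + be * P V x + be * P V y) - C * P I x * P I y =
    P (fun u => C * be * V u + (- (C * P I y) * I u + C * (1 + be * P V y))) x.
    by rewrite (mo_lin PJ (C * be) V) mo_affine; ring.
  by apply: (mo_le PJ) => // u Ju; have := H u Ju; rewrite mul1r; lra.
have PI0 u : J u -> 0 <= P I u.
  move=> Ju; rewrite -(mo_cst PJ 0 u).
  by apply: (mo_le PJ) => // v _; case/andP: (I01 v).
apply: le_trans coupling _.
have -> : C * (1 + be * P V x + be * P V y) - C * P I x * P I y =
   C * (1 + be * P V x + be * P V y - P I x * P I y) by ring.
rewrite -[leRHS]mulrA [leRHS]mulrCA ler_wpM2l//.
have Vx := V0 _ Jx; have Vy := V0 _ Jy.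
have bx : be * P V x <= be * (gam * V x + K) by rewrite ler_wpM2l ?PV// ltW.
have by' : be * P V y <= be * (gam * V y + K) by rewrite ler_wpM2l ?PV// ltW.
have s0' : 0 <= be * (V x + V y) by rewrite mulr_ge0 ?addr_ge0// ltW.
have [big|small] := leP ((4 * K + 2) / (1 - gam)) (V x + V y).
  have h1 : 0 <= P I x * P I y by rewrite mulr_ge0 ?PI0.
  have h2 : (1 + gam) / 2 * (be * (V x + V y)) <= al * (be * (V x + V y)) by rewrite ler_wpM2r.
  have h3 : be * (4 * K + 2) <= be * ((V x + V y) * (1 - gam)).
    by rewrite ler_wpM2l ?(ltW be0)// -ler_pdivrMr// subr_gt0.
  lra.
have ex : eps <= P I x by apply: Pz => //; lra.
have ey : eps <= P I y by apply: Pz => //; lra.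
have h1 : eps ^+ 2 <= P I x * P I y by rewrite expr2 ler_pM// ltW.
have h2 : gam * (be * (V x + V y)) <= al * (be * (V x + V y)) by rewrite ler_wpM2r//; lra.
lra.
Qed.

End markov_operator.

Section harris.
Local Open Scope classical_set_scope.
Variables (R : realType) (X : eqType).
Variables (J : X -> Prop) (P : (X -> R) -> X -> R).
Hypothesis PJ : markov_op J P.

(** Some iterate of [P] contracts oscillations weighted by [V], and the expectation of [V] stays
    bounded along the orbit of [x0]; hence the sequence is Cauchy. *)
Lemma harris_cvg (V : X -> R) (gam K : R) (z x0 : X) (f : X -> R) :
  0 <= gam -> gam < 1 -> 0 <= K ->
  (forall x, J x -> 0 <= V x) ->
  (forall x, J x -> P V x <= gam * V x + K) ->
  (forall r, exists n eps, [/\ (0 < n)%N, 0 < eps &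
    forall x, J x -> V x <= r -> eps <= iter n P (fun y => (y == z)%:R) x]) ->
  J x0 -> (exists C, forall x, J x -> `|f x| <= C * (1 + V x)) ->
  cvgn (fun k => iter k P f x0).
Proof.
move=> g0 g1 K0 V0 PV minor Jx0 [C fC].
pose K' := K / (1 - gam).
have K'0 : 0 <= K' by rewrite divr_ge0// subr_ge0 ltW.
(* [K'] bounds the drift error of all iterates at once, so the sublevel of [V] is fixed before [n]
   is known. *)
have [n [eps [n0 e0 nz]]] := minor ((4 * K' + 2) / (1 - gam)).
have PVn k x : J x -> iter k P V x <= gam ^+ k * V x + K' by exact: drift_iter.
have [|al [be [al0 al1 be0 contr]]] := weighted_contraction
  (markov_op_iter PJ n) g0 g1 K'0 e0 V0 _ nz.
  move=> x Jx; apply: le_trans (PVn n x Jx) _; rewrite lerD2r ler_wpM2r ?V0//.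
  by case: n n0 {nz PVn} => // n _; rewrite exprS ler_piMr// exprn_ile1// ltW.
(* This factor passes from the weight 1 + V to the weight 1 + be V. *)
pose C' := `|C| * (2 + be^-1).
have C'0 : 0 <= C' by rewrite mulr_ge0// addr_ge0// invr_ge0 ltW.
have fC' x y : J x -> J y -> f x - f y <= C' * (1 + be * V x + be * V y).
  move=> Jx Jy; have Vx := V0 _ Jx; have Vy := V0 _ Jy.
  have fle u : J u -> `|f u| <= `|C| * (1 + V u).
    move=> Ju; apply: le_trans (fC u Ju) _.
    by rewrite ler_wpM2r ?ler_norm// addr_ge0 ?V0.
  have h : f x - f y <= `|C| * (2 + V x + V y).
    apply: le_trans (ler_norm _) _; apply: le_trans (ler_normB _ _) _.
    have := fle x Jx; have := fle y Jy; lra.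
  apply: le_trans h _; rewrite /C' -mulrA ler_wpM2l//.
  have -> : (2 + be^-1) * (1 + be * V x + be * V y) =
    2 + V x + V y + (be^-1 + 2 * be * (V x + V y)) by field; rewrite gt_eqF.
  rewrite lerDl addr_ge0 ?invr_ge0 ?(ltW be0)//.
  by rewrite mulr_ge0 ?addr_ge0// mulr_ge0// ltW.
have contrm m x y : J x -> J y ->
    iter (m * n) P f x - iter (m * n) P f y
    <= al ^+ m * C' * (1 + be * V x + be * V y).
  elim: m x y => [|m IH] x y Jx Jy.
    by rewrite mul0n expr0 mul1r; exact: fC'.
  rewrite mulSn !iterD exprS -[al * _ * _]mulrA.
  by apply: contr => //; rewrite mulr_ge0// exprn_ge0.
pose D := C' * (1 + be * (V x0 + K') + be * V x0).
have D0 : 0 <= D.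
  have := V0 _ Jx0 => ?; rewrite mulr_ge0// !addr_ge0// mulr_ge0 ?(ltW be0)//.
  exact: addr_ge0.
(* The first [j] transitions replace g at [x0] by an average of g, and [D] bounds the averaged
   weight by means of [PVn]. *)
have osc m j : `|iter (j + m * n) P f x0 - iter (m * n) P f x0| <= al ^+ m * D.
  rewrite iterD; set g := iter (m * n) P f.
  have Pj := markov_op_iter PJ j.
  have bound (s : R) : `|s| = 1 -> s * (iter j P g x0 - g x0) <= al ^+ m * D.
    move=> s1.
    have -> : s * (iter j P g x0 - g x0) =
      iter j P (fun y => s * g y + (- (s * g x0))) x0.
      by rewrite (mo_affine Pj); ring.
    apply: le_trans (_ : iter j P (fun y =>
        al ^+ m * C' * be * V y + al ^+ m * C' * (1 + be * V x0)) x0 <= _).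
      apply: (mo_le Pj) => // y Jy.
      have -> : al ^+ m * C' * be * V y + al ^+ m * C' * (1 + be * V x0) =
        al ^+ m * C' * (1 + be * V y + be * V x0) by ring.
      rewrite -mulrBr; have h1 := contrm m _ _ Jy Jx0.
      have := contrm m _ _ Jx0 Jy; rewrite -/g in h1 *; move=> h2.
      apply: le_trans (ler_norm _) _; rewrite normrM s1 mul1r ler_norml.
      by apply/andP; split; lra.
    rewrite (mo_affine Pj) /D.
    have -> : al ^+ m * (C' * (1 + be * (V x0 + K') + be * V x0)) =
      al ^+ m * C' * be * (V x0 + K') + al ^+ m * C' * (1 + be * V x0) by ring.
    rewrite lerD2r ler_wpM2l//.
      by rewrite mulr_ge0 ?(ltW be0)// mulr_ge0// exprn_ge0.
    apply: le_trans (PVn j x0 Jx0) _; rewrite lerD2r ler_piMl ?V0//.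
    by rewrite exprn_ile1// ltW.
  rewrite ler_norml; have := bound 1 (normr1 _); have := bound (-1) (normrN1 _).
  by move=> ? ?; apply/andP; split; lra.
apply/cauchy_cvgP; apply: cauchy_exP => e egt0.
have [m almD] : exists m, al ^+ m * D < e.
  have : (fun m => al ^+ m * D) @ \oo --> 0 * D.
    by apply: cvgMl; apply: cvg_expr; rewrite ger0_norm.
  rewrite mul0r => /cvgrPdist_lt /(_ e egt0) [m _ /(_ m (leqnn m))] /=.
  by rewrite sub0r normrN => h; exists m; apply: le_lt_trans (ler_norm _) h.
exists (iter (m * n) P f x0); exists (m * n)%N => // k /= mk.
rewrite /ball /= distrC -(subnK mk).
exact: le_lt_trans (osc _ _) almD.
Qed.

End harris.

(** * The chain and its rounds *)

Section kernel.
Variables (R : realType) (M q : nat).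
Hypotheses (hM : (1 <= M)%N) (hq : (2 <= q)%N).
Implicit Types (s : state) (b : seq int) (d T : int) (t : nat) (f g : state -> R).

(** The backward operator of the chain; its iterates on indicators give the law at time n. *)
Definition trans f s : R := \sum_(x <- step R M q s) x.2 * f x.1.

Definition succ s : seq state := [seq x.1 | x <- step R M q s].

Lemma step_weight s :
  all (fun x => 0 <= x.2) (step R M q s) /\ \sum_(x <- step R M q s) x.2 = 1.
Proof.
have q0 : (0 : R) < q%:R by rewrite ltr0n; apply: leq_trans hq.
have q1 : (1 : R) <= q%:R by rewrite ler1n; apply: leq_trans hq.
rewrite /step; do ?case: ifP => _ /=; rewrite ?big_cons ?big_nil /= ?ler01 ?addr0;
  split => //.
  by rewrite andbT !divr_ge0 ?subr_ge0// ltW.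
by field; rewrite gt_eqF.
Qed.

Lemma trans_lin a f g s :
  trans (fun y => a * f y + g y) s = a * trans f s + trans g s.
Proof.
rewrite /trans mulr_sumr -big_split /=; apply: eq_bigr => x _; ring.
Qed.

Lemma trans_cst c s : trans (fun=> c) s = c.
Proof. by rewrite /trans -mulr_suml (step_weight s).2 mul1r. Qed.

Lemma trans_le f g s : (forall s', s' \in succ s -> f s' <= g s') ->
  trans f s <= trans g s.
Proof.
move=> fg; rewrite /trans big_seq [leRHS]big_seq; apply: ler_sum => x xs.
rewrite ler_wpM2l//; first by have [/allP/(_ x xs)] := step_weight s.
by apply: fg; exact: map_f.
Qed.

Lemma transE f s : trans f s =
  let: (b, d, T, t) := s in
  if (t <= M)%N then
    let no := f (b, d, T, t.+1) in
    if d < nth 0 b t.-1 then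
      (q%:R - 1) / q%:R * f (set_nth 0 b t.-1 d, nth 0 b t.-1, T, t.+1)
      + 1 / q%:R * no
    else no
  else if T < M%:Z then f (b, d - 1, T + 1, 1%N)
  else f ([seq x + 1 | x <- b], d, 0, 1%N).
Proof.
case: s => [[[b d] T] t]; rewrite /trans /step /sb /sd /sT /st /=.
by do ?case: ifP => _; rewrite ?big_cons big_nil /= addr0 ?mul1r.
Qed.

Lemma succE s : succ s =
  let: (b, d, T, t) := s in
  if (t <= M)%N then
    if d < nth 0 b t.-1 then
      [:: (set_nth 0 b t.-1 d, nth 0 b t.-1, T, t.+1); (b, d, T, t.+1)]
    else [:: (b, d, T, t.+1)]
  else if T < M%:Z then [:: (b, d - 1, T + 1, 1%N)]
  else [:: ([seq x + 1 | x <- b], d, 0, 1%N)].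
Proof.
case: s => [[[b d] T] t]; rewrite /succ /step /sb /sd /sT /st /=.
by do ?case: ifP.
Qed.

Lemma perm_set_nth b d i : (i < size b)%N ->
  perm_eq (nth 0 b i :: set_nth 0 b i d) (d :: b).
Proof.
move=> ib; apply/permP => a; rewrite set_nthE ib.
rewrite -[in RHS](cat_take_drop i b) (drop_nth 0 ib) /= !count_cat /=; lia.
Qed.

Lemma inSE b d T t : inS M (b, d, T, t) =
  [&& size b == M, (1 <= t)%N, (t <= M.+1)%N,
      d + T + \sum_(x <- b) x == 0, 0 <= T & T <= M%:Z].
Proof. by rewrite /inS /inSbar /sb /sd /sT /st /= -!andbA. Qed.

Lemma sum_shift b : \sum_(x <- [seq x + 1 | x <- b]) x = \sum_(x <- b) x + (size b)%:Z.
Proof.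
elim: b => [|x b IH] /=; first by rewrite !big_nil.
by rewrite !big_cons IH intS; ring.
Qed.

(** A swap permutes the summands, an ordinary kick keeps d + T, and in the reset the M batteries
    gain together the M that T loses. *)
Lemma succ_inS s s' : inS M s -> s' \in succ s -> inS M s'.
Proof.
case: s => [[[b d] T] t]; rewrite inSE succE.
move=> /and5P[/eqP sb t1 tM /eqP sum /andP[T0 TM]].
have [tlt|tge] := leqP t M.
  have [dlt|_] := ltP d (nth 0 b t.-1).
    have ib : (t.-1 < size b)%N by rewrite sb; lia.
    have : \sum_(x <- nth 0 b t.-1 :: set_nth 0 b t.-1 d) x = \sum_(x <- d :: b) x.
      exact: perm_big (perm_set_nth d ib).
    rewrite !big_cons => E.
    rewrite !inE => /orP[] /eqP ->; rewrite inSE ?size_set_nth.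
      by apply/and5P; split; [rewrite sb; lia|lia|lia| |lia];
        rewrite -addrA addrCA E addrCA addrA sum.
    by rewrite sb sum; lia.
  by rewrite inE => /eqP ->; rewrite inSE sb; apply/and5P; split; [lia|lia|lia|exact/eqP|lia].
case: ifP => TlM; rewrite inE => /eqP ->; move: sum; rewrite inSE ?size_map ?sum_shift sb;
  move: (\sum_(x <- b) x) => S sum; lia.
Qed.

(** Possible paths of length [n]; they allow expectations to be compared on reachable states
    only. *)
Fixpoint reach n s s' : Prop :=
  if n is n'.+1 then exists2 x, x \in succ s & reach n' x s' else s = s'.

Lemma iter_trans_le n f g s : (forall s', reach n s s' -> f s' <= g s') ->
  iter n trans f s <= iter n trans g s.
Proof.
elim: n s => [|n IH] s fg /=; first exact: fg.
by apply: trans_le => x xs; apply: IH => s' xs'; apply: fg; exists x.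
Qed.

Lemma reach_inS n s s' : inS M s -> reach n s s' -> inS M s'.
Proof.
elim: n s => [|n IH] s Ss /=; first by move=> <-.
by move=> [x xs]; apply: IH; exact: succ_inS xs.
Qed.

(** The deterministic clock of the chain within a period. *)
Definition phase s : nat := (`|sT s| * M.+1 + st s)%N.

(** At t = M+1 the clock reads (T+1)(M+1), so passing to t = 1 of the next round is again an
    increase by 1; at T = M the reading is (M+1)^2 and the clock wraps around. *)
Lemma reach_phase n s s' : inS M s -> reach n s s' ->
  phase s' = phase s + n %[mod M.+1 * M.+1].
Proof.
elim: n s => [|n IH] s Ss /=; first by move=> <-; rewrite addn0.
move=> [x xs xs']; rewrite (IH _ _ xs'); last exact: succ_inS xs.
suff : phase x = phase s + 1 %[mod M.+1 * M.+1].
  by move=> E; rewrite -modnDml E modnDml -addnA add1n.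
move: Ss xs; case: s => [[[b d] T] t]; rewrite inSE succE /phase.
move=> /and5P[/eqP sb t1 tM /eqP sum /andP[T0 TM]].
have [tlt|tge] := leqP t M.
  by case: ifP => _; rewrite !inE; [move=> /orP[] |]; move=> /eqP->;
    rewrite /sT /st /= addn1 addnS.
have -> : t = M.+1 by lia.
case: ifP => TlM; rewrite inE => /eqP ->; rewrite /sT /st /=.
  by congr (_ %% _)%N; rewrite (_ : absz (T + 1) = (absz T).+1); lia.
have -> : absz T = M by lia.
by rewrite mul0n add0n -mulSnr modnDl.
Qed.

Definition lev T x : int := M.+1%:Z * x + T.
Definition levels s : seq int := [seq lev (sT s) x | x <- sd s :: sb s].

(** In the rest of a sweep d is only ever exchanged for a larger battery. *)
Lemma reach_sweep n s s' : size (sb s) = M -> (1 <= st s)%N ->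
  (st s + n = M.+1)%N -> reach n s s' ->
  [/\ st s' = M.+1, sT s' = sT s, size (sb s') = M,
      perm_eq (sd s' :: sb s') (sd s :: sb s) & sd s <= sd s'].
Proof.
elim: n s => [|n IH] s sM t1 tn /=; first by move=> <-; split => //; lia.
case: s sM t1 tn => [[[b d] T] t]; rewrite /sb /sd /sT /st /= => sM t1 tn.
move=> [x]; rewrite succE (_ : (t <= M)%N = true); last lia.
case: ifP => dlt; rewrite !inE; [move=> /orP[]|]; move=> /eqP -> /IH.
- rewrite /sb /sd /sT /st /= size_set_nth => H.
  have [|||-> -> -> p le] := H; [lia|lia|lia|split => //].
    by apply: perm_trans p _; apply: perm_set_nth; lia.
  by apply: le_trans le; rewrite ltW.
- by apply => //=; lia.
- by apply => //=; lia.
Qed.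

End kernel.

(** * Geometric drift *)

Section drift_inequality.
Variable R : realType.

Lemma bernoulli (a : R) n : -1 <= a -> 1 + n%:R * a <= (1 + a) ^+ n.
Proof.
move=> a0; elim: n => [|n IH]; first by rewrite mul0r addr0.
rewrite exprS; apply: le_trans (_ : (1 + a) * (1 + n%:R * a) <= _).
  rewrite -natr1; have : 0 <= a * a * n%:R by rewrite mulr_ge0 ?sqr_ge0.
  lra.
rewrite ler_wpM2l//; lra.
Qed.

(** Case of [D] clearly below the top battery weight [y]. A swap discounts the weight brought to d
    and restores the one released; the net gain, about (k / 16) (y - D) >= k^2 y / 128, beats the
    battery growth al X <= k^2 y / 256. *)
Lemma drift_swap (k al kap u X y D EV : R) :
  0 <= k -> k <= 1 -> 0 <= al -> al <= k * k / 256 -> 0 <= kap -> kap <= al / 8 ->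
  u <= 1 -> 0 <= D -> 0 <= y ->
  al * X <= k * k / 256 * y -> kap * X <= al / 8 * y -> D < (1 - k / 8) * y ->
  EV <= (1 + al) * X + u * D - (k / 16) * ((1 + al) * y + u * D) ->
  EV <= (1 - kap) * (X + (1 - k / 8) * D).
Proof.
move=> k0 k1 al0 alk kap0 kap1 u1 D0 y0 alX kapX Dy ub.
have ky := mulr_ge0 k0 y0; have kD := mulr_ge0 k0 D0.
have kaly := mulr_ge0 k0 (mulr_ge0 al0 y0).
have Dy1 : D <= y by lra.
have kapD : kap * ((1 - k / 8) * D) <= al / 8 * y.
  by apply: ler_pM => //; [apply: mulr_ge0|]; lra.
have aly := ler_wpM2r y0 alk.
have uD : 0 <= (1 - u) * D by apply: mulr_ge0 => //; lra.
have kuD : 0 <= (1 - k) * ((1 - u) * D) by apply: mulr_ge0 => //; lra.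
have kDy := ler_wpM2l k0 (ltW Dy).
have k2y := mulr_ge0 k0 ky.
clear - alX kapX kapD aly uD kuD kDy k2y kaly ub.
lra.
Qed.

(** Case of [D] comparable to [y]. The kick costs d about e D, while the batteries, one of which has
    weight at most 1, grow by at most (e - al) y + al; a loss of order al y remains. *)
Lemma drift_kick (m k e al kap u X y D EV : R) :
  0 <= k -> k <= 1 -> e = k * k / 256 -> al * m = e -> e * k = al ->
  0 <= kap -> kap <= al / 8 -> u * (1 + e) <= 1 -> 1 - e <= u ->
  0 <= D -> 0 <= y -> kap * X <= al / 8 * y -> (1 - k / 8) * y <= D ->
  X <= (m - 1) * y + 1 ->
  EV <= (1 + al) * X + (1 - k / 8) * (u * D) ->
  EV <= (1 - kap) * (X + (1 - k / 8) * D) + al.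
Proof.
move=> k0 k1 eE alm ek kap0 kap1 uu ulb D0 y0 kapX yD X1 ub.
have ky := mulr_ge0 k0 y0.
have kky : 0 <= k * ((1 - k) * y) by apply: mulr_ge0 => //; apply: mulr_ge0 => //; lra.
have yD' : y <= (1 + k / 7) * D.
  have k7 : 0 <= 1 + k / 7 by lra.
  have := ler_wpM2l k7 yD; clear - kky; lra.
have e0 : 0 <= e by rewrite eE; have := mulr_ge0 k0 k0; lra.
have al0 : 0 <= al by rewrite -ek mulr_ge0.
have eD0 := mulr_ge0 e0 D0.
have keD : k * (e * D) = al * D by rewrite -ek; ring.
have alD := mulr_ge0 al0 D0.
have eeD : e * (e * D) <= al * D / 256.
  have -> : e * (e * D) = k * (al * D) / 256 by rewrite -keD {1}eE; ring.
  by rewrite ler_wpM2r// ler_piMl.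
have eeD0 := mulr_ge0 e0 eD0.
have uD : u * D <= D - e * D + e * (e * D).
  have u_le : u <= 1 - e * (1 - e).
    by have := ler_wpM2l e0 ulb; clear - uu; lra.
  by have := ler_wpM2r D0 u_le; clear; lra.
have alX : al * X <= (e - al) * y + al.
  by have := ler_wpM2l al0 X1; rewrite -alm; clear; lra.
have ale : 0 <= e - al by rewrite -ek subr_ge0 ler_piMr.
have ey := ler_wpM2l ale yD'.
have aly : al / 8 * y <= al / 8 * (8 / 7 * D).
  apply: ler_wpM2l; first lra.
  have : k * D <= D by rewrite ler_piMl.
  by clear - yD'; lra.
have kcD : kap * ((1 - k / 8) * D) <= al / 8 * D.
  apply: ler_pM => //; first by apply: mulr_ge0 => //; lra.
  by rewrite ler_piMl//; lra.
have c0 : 0 <= 1 - k / 8 by lra.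
have cuD := ler_wpM2l c0 uD.
have keeD := mulr_ge0 k0 eeD0.
have kalD := mulr_ge0 k0 alD.
clear - kalD keD alD eeD alX ey aly kcD cuD keeD kapX ub.
lra.
Qed.

(* [X] and [y] are the sum and the maximum of the exponential weights of the
   batteries, [D] is the weight of the discrepancy, [EV] the expected Lyapunov
   function after one round. *)
Lemma drift_inequality M : (1 <= M)%N ->
  exists A c gam K : R, [/\ 1 < A, 0 < c, c < 1 &
    [/\ 0 <= gam, gam < 1, 0 <= K &
  forall X y D EV : R, 0 <= D -> 0 <= y -> y <= X -> X <= M%:R * y ->
    D <= 1 \/ X <= (M%:R - 1) * y + 1 ->
    EV <= A * X + c * (A ^- M * D) ->
    EV <= A * X + A ^- M * D - (1 - c) / 2 * (A * y + A ^- M * D) ->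
    EV <= gam * (X + c * D) + K]].
Proof.
move=> M0; have m1 : (1 : R) <= M%:R by rewrite ler1n.
have [k [km k0 k1]] : exists k : R, [/\ k * M%:R = 1, 0 < k & k <= 1].
  have m0 : (0 : R) < M%:R by lra.
  by exists M%:R^-1; rewrite mulVf ?invr_gt0 ?invf_le1// gt_eqF.
have k2 : k * k <= k by rewrite ler_piMl// ltW.
have kk0 := mulr_gt0 k0 k0; have kkk0 := mulr_gt0 k0 kk0.
have k3 : k * (k * k) <= k * k by rewrite ler_piMl// ltW.
(* A = 1 + al; [e] = al M is to first order the relative loss of d in a kick; [kap] is the rate of
   decay kept in the end. The powers of k = 1/M make each loss dominate the next error. *)
have [al alE] : exists al, al = k * (k * k) / 256 by exists (k * (k * k) / 256).
have al0 : 0 < al by lra.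
have al1 : al <= 1 / 256 by lra.
have [e eE] : exists e, e = k * k / 256 by exists (k * k / 256).
have alm : al * M%:R = e.
  by transitivity (k * k * (k * M%:R) / 256); [rewrite alE; field|rewrite km mulr1].
have ek : e * k = al by rewrite eE alE; field.
have [kap kapE] : exists kap, kap = al * k / 8 by exists (al * k / 8).
have kap0 : 0 < kap by rewrite kapE divr_gt0// mulr_gt0.
have kap1 : kap <= al / 8 by rewrite kapE ler_wpM2r// ler_piMr// ltW.
have kapm : kap * M%:R = al / 8.
  by transitivity (al * (k * M%:R) / 8); [rewrite kapE; field|rewrite km mulr1].
have A0 : 0 < 1 + al by lra.
have An0 : 0 < (1 + al) ^+ M by rewrite exprn_gt0.
have [u [u0 uE]] : exists u, 0 < u /\ u = (1 + al) ^- M.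
  by exists ((1 + al) ^- M); rewrite invr_gt0.
(* Bernoulli's inequality for 1 + al and for 1 - al encloses u = A^-M between 1 - e and 1 / (1 +
   e). *)
have uu : u * (1 + e) <= 1.
  rewrite uE mulrC ler_pdivrMr// mul1r -alm [al * _]mulrC; apply: bernoulli; lra.
have u1 : u <= 1.
  by apply: le_trans uu; rewrite ler_peMr ?(ltW u0)// eE; lra.
have ulb : 1 - e <= u.
  rewrite uE -[leRHS]mul1r ler_pdivlMr//.
  apply: le_trans (_ : (1 - al) ^+ M * (1 + al) ^+ M <= _).
    rewrite ler_wpM2r ?(ltW An0)// -alm [al * _]mulrC -mulrN.
    by apply: bernoulli; lra.
  rewrite -exprMn exprn_ile1//; first by apply: mulr_ge0; lra.
  by have := mulr_gt0 al0 al0; clear; lra.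
exists (1 + al), (1 - k / 8), (1 - kap), (4 * M%:R + 1).
split; [lra|lra|lra|split; [lra|lra|lra|]].
move=> X y D EV D0 y0 yX Xy small; rewrite -uE => ub1 ub2.
have X0 : 0 <= X by exact: le_trans yX.
have kapX : kap * X <= al / 8 * y.
  by rewrite -kapm -mulrA ler_wpM2l// ltW.
have alX : al * X <= e * y by rewrite -alm -mulrA ler_wpM2l// ltW.
have [Dy|yD] := ltP D ((1 - k / 8) * y).
  apply: le_trans (_ : (1 - kap) * (X + (1 - k / 8) * D) <= _); last by rewrite lerDl; lra.
  apply: (drift_swap (y := y) (al := al) (u := u)) => //; try exact: ltW.
  - by rewrite alE; lra.
  - by rewrite -eE.
  - by move: ub2; clear; lra.
(* If D <= 1, then y and X are bounded too, and the constant [K] absorbs [EV]. *)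
case: small => [D1|X1].
  have y2 : y <= 8 / 7.
    have ky : k * y <= y by rewrite ler_piMl.
    by clear - ky yD D1; lra.
  have Xm : X <= M%:R * (8 / 7).
    by apply: le_trans Xy _; rewrite ler_wpM2l// (le_trans _ m1).
  have alX' : al * X <= X by rewrite ler_piMl//; lra.
  have cuD : (1 - k / 8) * (u * D) <= 1.
    rewrite mulr_ile1 ?mulr_ge0 ?mulr_ile1 ?(ltW u0)//; lra.
  have : 0 <= (1 - kap) * (X + (1 - k / 8) * D).
    by apply: mulr_ge0; [lra|apply: addr_ge0 => //; apply: mulr_ge0 => //; lra].
  by clear - ub1 alX' Xm cuD m1; lra.
apply: le_trans (_ : (1 - kap) * (X + (1 - k / 8) * D) + al <= _); last first.
  by rewrite lerD2l; lra.
apply: (drift_kick (m := M%:R) (y := y) (e := e) (u := u)) => //; exact: ltW.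
Qed.

End drift_inequality.

(** * Levels and energy over one round *)

Section round.
Variables (R : realType) (M q : nat).
Hypotheses (hM : (1 <= M)%N) (hq : (2 <= q)%N).
Implicit Types (s : state) (b : seq int) (d T : int) (t : nat) (f g : state -> R).
Local Notation trans := (@trans R M q).
Local Notation succ := (@succ R M q).
Local Notation reach := (@reach R M q).
Local Notation lev := (lev M).
Local Notation levels := (levels M).

(** End of a round, just before the kick: the states over which the theorem averages d. *)
Definition col s : bool := inS M s && (st s == M.+1).

Definition kick s : state :=
  if sT s < M%:Z then (sb s, sd s - 1, sT s + 1, 1%N)
  else ([seq x + 1 | x <- sb s], sd s, 0, 1%N).

Lemma succ_kick s : col s -> succ s = [:: kick s].
Proof.
case: s => [[[b d] T] t] /andP[_ /eqP]; rewrite /st /= => ->.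
by rewrite succE ltnn /kick /sT /sb /sd /=; case: ifP.
Qed.

Lemma trans_kick f s : col s -> trans f s = f (kick s).
Proof.
case: s => [[[b d] T] t] /andP[_ /eqP]; rewrite /st /= => ->.
by rewrite transE ltnn /kick /sT /sb /sd /=; case: ifP.
Qed.

Lemma colE b d T t : col (b, d, T, t) =
  [&& inS M (b, d, T, t) & t == M.+1].
Proof. by []. Qed.

(** On levels both kinds of kick coincide: raising T adds 1 to every level, and in the reset each
    battery gains M+1 from its own increment and loses M with T. *)
Lemma levels_kick s : col s ->
  levels (kick s) = lev (sT s) (sd s) - M%:Z
     :: [seq lev (sT s) x + 1 | x <- sb s].
Proof.
case: s => [[[b d] T] t]; rewrite colE inSE => /andP[/and5P[/eqP sM _ _ _ /andP[T0 TM]] _].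
rewrite /levels /kick /sT /sb /sd /lev /=; case: ltP => TltM /=.
  congr cons; first by lia.
  by apply: eq_map => x; lia.
have -> : T = M%:Z by lia.
congr cons; first by lia.
by rewrite -map_comp; apply: eq_map => x /=; lia.
Qed.

Lemma sum_levels s : inS M s -> \sum_(v <- levels s) v = 0.
Proof.
case: s => [[[b d] T] t]; rewrite inSE => /and5P[/eqP sM _ _ /eqP sum _].
rewrite /levels /sT /sb /sd /= big_cons.
have -> : \sum_(v <- [seq lev T x | x <- b]) v =
    M.+1%:Z * (\sum_(x <- b) x) + (size b)%:Z * T.
  elim: b {sM sum} => [|x b IH] /=; first by rewrite !big_nil; ring.
  by rewrite !big_cons IH /lev intS; ring.
rewrite sM /lev; move: sum; set S := \sum_(x <- b) x => sum.
have -> : S = - d - T by apply/eqP; rewrite -subr_eq0 -sum; apply/eqP; ring.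
by rewrite intS; ring.
Qed.

(** A round is a kick followed by a sweep through all batteries. *)
Lemma reach_round s s' : col s -> reach M.+1 s s' ->
  [/\ col s', sT s' = sT (kick s), reach M (kick s) s',
    perm_eq (levels s') (levels (kick s)) & sd (kick s) <= sd s'].
Proof.
move=> cs rs; have /andP[Ss ts] := cs.
have Ss' := reach_inS hM hq Ss rs.
move: rs => /= [x]; rewrite succ_kick// inE => /eqP-> rs.
have [|||ts' Ts' sM p le] := reach_sweep hM hq _ _ _ rs.
- move: Ss; case: s {cs ts rs} => [[[b d] T] t]; rewrite inSE => /andP[/eqP sM _].
  by rewrite /kick; case: ifP => _; rewrite /sb /= ?size_map.
- by rewrite /kick; case: ifP.
- by rewrite /kick; case: ifP; rewrite /st /= add1n.
- split => //.
  + by rewrite /col Ss' ts' eqxx.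
  + by rewrite /levels Ts'; apply: perm_map.
Qed.

Lemma markov_trans : markov_op (inS M) trans.
Proof.
split; [exact: trans_lin|exact: trans_cst|].
by move=> f g fg s Ss; apply: trans_le => // s' /(succ_inS hM hq Ss); exact: fg.
Qed.

Definition round f : state -> R := iter M.+1 trans f.

Lemma markov_round : markov_op col round.
Proof.
split.
- exact: mo_lin (markov_op_iter markov_trans _).
- exact: mo_cst (markov_op_iter markov_trans _).
- move=> f g fg s cs; apply: iter_trans_le => // s' rs; apply: fg.
  by have [] := reach_round cs rs.
Qed.

Definition energy s : int := \sum_(v <- levels s) v ^+ 2.

(** Write l for the level of d. Expanding (l - M)^2 and the (v + 1)^2 of the batteries, whose levels
    sum to -l, gives the cross term -2 (M+1) l and the constant M^2 + M. *)
Lemma energy_round s s' : col s -> reach M.+1 s s' ->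
  energy s' = energy s - 2 * M.+1%:Z * lev (sT s) (sd s) + M%:Z * M.+1%:Z.
Proof.
move=> cs rs; have [_ _ _ p _] := reach_round cs rs.
rewrite /energy (perm_big _ p) /= levels_kick// big_cons big_map.
have /andP[Ss _] := cs; have := sum_levels Ss.
rewrite /levels !big_cons !big_map => sum0.
have sM : size (sb s) = M.
  by move: Ss; rewrite /inS /inSbar => /andP[/and4P[/eqP]].
have -> : \sum_(x <- sb s) (lev (sT s) x + 1) ^+ 2 =
   \sum_(x <- sb s) lev (sT s) x ^+ 2 + 2 * (\sum_(x <- sb s) lev (sT s) x) + (size (sb s))%:Z.
  elim: (sb s) => [|x b IH]; first by rewrite !big_nil.
  by rewrite !big_cons IH /= [(size b).+1%:Z]intS; ring.
have -> : \sum_(x <- sb s) lev (sT s) x = - lev (sT s) (sd s) by apply/eqP; rewrite -addr_eq0 addrC sum0.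
by rewrite sM intS; ring.
Qed.

(** When battery [m] has its turn, either d is already as large or the swap takes place with
    probability 1 - 1/q >= 1/2; at all other times d does not decrease. *)
Lemma sweep_gain (h : int -> R) n s m : {homo h : x y / x <= y} ->
  size (sb s) = M -> (1 <= st s)%N -> (st s + n = M.+1)%N ->
  ((st s).-1 <= m)%N -> (m < M)%N ->
  (h (nth 0 (sb s) m) + h (sd s)) / 2 <= iter n trans (h \o @sd) s.
Proof.
move=> hh; have q0 : (0 : R) < q%:R by rewrite ltr0n; apply: leq_trans hq.
have q2 : (2 : R) <= q%:R by rewrite ler_nat.
have ge_start n' s' : size (sb s') = M -> (1 <= st s')%N -> (st s' + n' = M.+1)%N ->
    h (sd s') <= iter n' trans (h \o @sd) s'.
  move=> sM t1 tn; rewrite -[leLHS](mo_cst (markov_op_iter markov_trans n') _ s').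
  apply: iter_trans_le => // u /(reach_sweep hM hq sM t1 tn)[_ _ _ _ le] /=; exact: hh.
elim: n s => [|n IH] s sM t1 tn mt mM; first lia.
case: s sM t1 tn mt => [[[b d] T] t]; rewrite /sb /sd /sT /st /= => sM t1 tn mt.
rewrite transE (_ : (t <= M)%N = true) /=; last lia.
have no : h d <= iter n trans (h \o @sd) (b, d, T, t.+1) 
  by exact: (ge_start n (b, d, T, t.+1) sM isT ltac:(rewrite /st /=; lia)).
have q01 : 0 <= (q%:R : R)^-1 <= 1/2.
  by rewrite invr_ge0 ltW//= mul1r lef_pV2// posrE.
rewrite mulrBl mulfV ?gt_eqF// div1r.
have [mE|mt'] := eqVneq m t.-1.
  rewrite mE; case: ltP => dlt; last first.
    by have := hh _ _ dlt; lra.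
  have := ge_start n (set_nth 0 b t.-1 d, nth 0 b t.-1, T, t.+1).
  rewrite /sb /sd /st /= size_set_nth => /(_ _ _ _) H.
  have {H} yes := H ltac:(lia) isT ltac:(lia).
  have hd := hh _ _ (ltW dlt).
  set Y := iter n _ _ _ in yes *; set N := iter n _ _ _ in no *.
  set p := _^-1 in q01 *.
  have : (1 - p) * h (nth 0 b t.-1) <= (1 - p) * Y by rewrite ler_wpM2l//; lra.
  have : p * h d <= p * N by rewrite ler_wpM2l//; lra.
  have : p * (h (nth 0 b t.-1) - h d) <= 1/2 * (h (nth 0 b t.-1) - h d).
    by rewrite ler_wpM2r//; lra.
  lra.
(* Battery [m] is still ahead: this transition leaves it alone and can only raise d, so induction
   applies to both branches. *)
have := IH (b, d, T, t.+1); rewrite /sb /sd /st /= => H.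
have {H} IHno := H sM isT ltac:(lia) ltac:(lia) mM.
case: ltP => dlt //.
have := IH (set_nth 0 b t.-1 d, nth 0 b t.-1, T, t.+1); rewrite /sb /sd /st /= size_set_nth => H.
have {H} := H ltac:(lia) isT ltac:(lia) ltac:(lia) mM.
rewrite nth_set_nth /= (negbTE mt') => IHyes.
have hd := hh _ _ (ltW dlt).
set Y := iter n _ _ _ in IHyes *; set N := iter n _ _ _ in IHno *.
set p := _^-1 in q01 *; set x := h (nth 0 b m) in IHyes IHno *.
have : (1 - p) * ((x + h d) / 2) <= (1 - p) * Y by rewrite ler_wpM2l//; lra.
have : p * ((x + h d) / 2) <= p * N by rewrite ler_wpM2l//; lra.
lra.
Qed.

End round.

(** * The Lyapunov function and its drift *)

Section lyapunov.
Variables (R : realType) (M q : nat).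
Hypotheses (hM : (1 <= M)%N) (hq : (2 <= q)%N).
Implicit Types (s : state) (b : seq int) (d T : int) (t : nat).
Local Notation trans := (@trans R M q).
Local Notation reach := (@reach R M q).
Local Notation round := (@round R M q).
Local Notation lev := (lev M).
Local Notation levels := (levels M).

Lemma seq_max_int (l : seq int) : l != [::] ->
  exists2 y, y \in l & forall x, x \in l -> x <= y.
Proof.
elim: l => [//|a [|a' l] IH] _.
  by exists a; rewrite ?mem_head// => x; rewrite inE => /eqP->.
have [//|y yl ymax] := IH.
have [ay|ya] := leP a y.
  exists y; first by rewrite in_cons yl orbT.
  by move=> x; rewrite in_cons => /orP[/eqP->//|/ymax].
exists a; first exact: mem_head.
move=> x; rewrite in_cons => /orP[/eqP->//|/ymax xy].
by apply: le_trans xy _; rewrite ltW.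
Qed.

Lemma sb_size s : inS M s -> size (sb s) = M.
Proof. by rewrite /inS /inSbar => /andP[/and4P[/eqP]]. Qed.

Definition lyap (A c : R) s : R :=
  \sum_(x <- sb s) A ^ lev (sT s) x + c * A ^ lev (sT s) (sd s).

Lemma lyap_ge0 A c s : 0 < A -> 0 < c -> 0 <= lyap A c s.
Proof.
move=> A0 c0; rewrite addr_ge0 ?sumr_ge0// => [x _|]; rewrite ?mulr_ge0 ?exprz_ge0//; exact: ltW.
Qed.

(** The sweep preserves the total weight S, so the Lyapunov function after it is S - (1 - c) times
    the weight of d. The first bound uses that d does not decrease in the sweep, the second the gain
    from battery [m]. *)
Lemma lyap_round A c s (y := \sum_(x <- sb s) A ^ lev (sT s) x) m :
  1 < A -> 0 < c -> c < 1 -> col M s -> (m < M)%N ->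
  let D := A ^ lev (sT s) (sd s) in
  let B := A ^ lev (sT s) (nth 0 (sb s) m) in
  round (lyap A c) s <= A * y + c * (A ^- M * D) /\
  round (lyap A c) s <= A * y + A ^- M * D - (1 - c) / 2 * (A * B + A ^- M * D).
Proof.
move=> A1 c0 c1 cs mM D B.
have A0 : 0 < A by lra.
have An0 : A != 0 by rewrite gt_eqF.
have [Ss _] := andP cs; have sM := sb_size Ss.
pose h x := A ^ lev (sT (kick M s)) x.
have hh : {homo h : x y / x <= y}.
  move=> x x' xx'; rewrite /h; apply: ler_weXz2l; first exact: ltW.
  by rewrite /lev lerD2r ler_wpM2l.
have := levels_kick hM hq cs; rewrite [levels (kick M s)]/=.
case=> kd kb.
have hd : h (sd (kick M s)) = A ^- M * D.
  by rewrite /h kd addrC expfzDr// exprnN.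
have hb : h (nth 0 (sb (kick M s)) m) = A * B.
  have sMk : size (sb (kick M s)) = M.
    by have := congr1 size kb; rewrite !size_map sM.
  have := congr1 (nth 0 ^~ m) kb.
  rewrite (nth_map 0) ?sMk// (nth_map 0) ?sM// /h => ->.
  by rewrite addrC expfzDr// expr1z.
pose S := A * y + A ^- M * D.
have SE u : reach M (kick M s) u -> lyap A c u = - (1 - c) * h (sd u) + S.
  move=> ru; have : reach M.+1 s u by exists (kick M s); rewrite ?succ_kick ?mem_head.
  move=> /(reach_round hM hq cs)[_ Tu _ p _].
  have : \sum_(v <- levels u) A ^ v = \sum_(v <- levels (kick M s)) A ^ v by exact: perm_big p.
  rewrite (levels_kick hM hq cs) /levels !big_cons !big_map Tu -/(h _) => E.
  rewrite /lyap Tu -/(h _).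
  have -> : S = \sum_(x <- sb u) A ^ lev (sT (kick M s)) x + h (sd u).
    rewrite [RHS]addrC E /S addrC; congr (_ + _).
      by rewrite [RHS]expfzDr// exprnN mulrC.
    rewrite /y mulr_sumr; apply: eq_bigr => x _.
    by rewrite [RHS]expfzDr// expr1z mulrC.
  ring.
have rV : round (lyap A c) s <= - (1 - c) * iter M trans (h \o @sd) (kick M s) + S.
  rewrite /round iterS trans_kick// -(mo_affine (markov_op_iter (markov_trans R hM hq) M)).
  by apply: iter_trans_le => // u /SE ->.
have g1 : A ^- M * D <= iter M trans (h \o @sd) (kick M s).
  rewrite -hd -[leLHS](mo_cst (markov_op_iter (markov_trans R hM hq) M) _ (kick M s)).
  apply: iter_trans_le => // u ru; apply: hh.
  have : reach M.+1 s u by exists (kick M s); rewrite ?succ_kick ?mem_head.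
  by move=> /(reach_round hM hq cs)[].
have g2 : (A * B + A ^- M * D) / 2 <= iter M trans (h \o @sd) (kick M s).
  rewrite -hd -hb; apply: (sweep_gain hM hq hh) => //.
  - by have := congr1 size kb; rewrite !size_map sM.
  - by rewrite /kick; case: ifP.
  - by rewrite /kick; case: ifP; rewrite /st /= add1n.
  - by rewrite /kick; case: ifP.
have c1' : 0 <= 1 - c by lra.
split; apply: le_trans rV _.
  by have := ler_wpM2l c1' g1; rewrite /S; lra.
by have := ler_wpM2l c1' g2; rewrite /S; lra.
Qed.

(** The drift inequality is applied with [m] the position of the largest battery. *)
Lemma lyap_drift : exists A c gam K : R,
  [/\ 1 < A, 0 < c, 0 <= gam & [/\ gam < 1, 0 <= K &
  forall s, col M s -> round (lyap A c) s <= gam * lyap A c s + K]].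
Proof.
have [A [c [gam [K [A1 c0 c1 [g0 g1 K0 ineq]]]]]] := drift_inequality R hM.
exists A, c, gam, K; split => //; split => // s cs.
have A0 : 0 < A by lra.
have [Ss _] := andP cs; have sM := sb_size Ss.
have [|xm xmb xmax] := seq_max_int (l := sb s).
  by rewrite -size_eq0 sM; case: M hM.
have mM : (index xm (sb s) < M)%N by rewrite -[ltnRHS]sM index_mem.
have [] := lyap_round A1 c0 c1 cs mM; rewrite nth_index//.
set D := A ^ lev (sT s) (sd s); set y := A ^ _ xm; set X := \sum_(x <- _) _ => ub1 ub2.
have E0 v : 0 <= A ^ v by rewrite exprz_ge0 ?ltW.
have mono x : x \in sb s -> A ^ lev (sT s) x <= y.
  move=> /xmax xx; apply: ler_weXz2l; first exact: ltW.
  by rewrite /lev lerD2r ler_wpM2l.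
have sumle (l : seq int) : {subset l <= sb s} ->
    \sum_(x <- l) A ^ lev (sT s) x <= (size l)%:R * y.
  elim: l => [|a l IH] sub; first by rewrite big_nil mul0r.
  rewrite big_cons /= -natr1 mulrDl mul1r addrC lerD//.
    by apply: IH => x xl; apply: sub; rewrite in_cons xl orbT.
  by apply: mono; apply: sub; exact: mem_head.
rewrite -/D /lyap -/X -/D; apply: ineq ub1 ub2; rewrite ?/D ?/y ?E0//.
- by rewrite /X (big_rem _ xmb) /= lerDl sumr_ge0.
- by have := sumle (sb s) (fun _ => id); rewrite sM.
have [d0|d0] := leP (lev (sT s) (sd s)) 0.
  left; rewrite /D -(expr0z A); apply: ler_weXz2l => //; exact: ltW.
right.
(* The levels sum to 0, so if that of d is positive, some battery has level at most 0 and hence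
   weight at most 1. *)
have [x xb x0] : exists2 x, x \in sb s & lev (sT s) x <= 0.
  apply: contrapT => nex.
  have := sum_levels Ss; rewrite /levels big_cons big_map => sum0.
  have : 0 <= \sum_(x <- sb s) lev (sT s) x.
    rewrite big_seq; apply: sumr_ge0 => x xb; rewrite leNgt; apply/negP => xneg.
    by apply: nex; exists x => //; exact: ltW.
  by move: sum0 d0; move: (\sum_(x <- _) _) => S; lia.
rewrite /X (big_rem _ xb) /= addrC lerD//.
  have -> : M%:R - 1 = (size (rem x (sb s)))%:R :> R.
    by rewrite size_rem// sM -[in LHS](prednK hM) -natr1 addrK.
  by apply: sumle => z /mem_rem.
rewrite -(expr0z A); apply: ler_weXz2l => //; exact: ltW.
Qed.

(** Since the levels sum to 0, each is at most M y in absolute value, with y the largest; and A^y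
    dominates y^2. *)
Lemma energy_lyap (A c : R) : 1 < A -> 0 < c ->
  exists2 C, 0 <= C & forall s, inS M s -> (energy M s)%:~R <= C * lyap A c s.
Proof.
move=> A1 c0; have A0 : 0 < A by lra.
(* Thus A^n = ((1 + a)^n)^2 >= (n a)^2 by Bernoulli. *)
pose a := Num.sqrt A - 1.
have a0 : 0 < a by rewrite subr_gt0 -sqrtr1 ltr_sqrt.
have sq n : (n%:R * a) ^+ 2 <= A ^+ n.
  have -> : A ^+ n = ((1 + a) ^+ n) ^+ 2.
    by rewrite /a addrC subrK -exprM mulnC exprM sqr_sqrtr// ltW.
  apply: le_trans (_ : (1 + n%:R * a) ^+ 2 <= _).
    by rewrite lerXn2r ?nnegrE ?addr_ge0 ?mulr_ge0 ?(ltW a0)// lerDr.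
  have an0 : 0 <= n%:R * a by rewrite mulr_ge0// ltW.
  rewrite lerXn2r ?nnegrE ?exprn_ge0//; [lra|lra|].
  by apply: bernoulli; lra.
(* The largest level may be that of d, with factor c, or of a battery, with factor 1. *)
have [c' c'0 c'le] : exists2 c' : R, 0 < c' & c' <= c /\ c' <= 1.
  by exists (Num.min c 1); rewrite ?lt_min ?c0 ?ltr01// !ge_min !lexx orbT.
have C0 : 0 <= M.+1%:R * (M ^ 2)%:R / (a ^+ 2 * c').
  by apply: divr_ge0; apply: mulr_ge0; rewrite ?sqr_ge0// ltW.
exists (M.+1%:R * (M ^ 2)%:R / (a ^+ 2 * c')) => //.
move=> s Ss; have sM := sb_size Ss; have sum0 := sum_levels Ss.
have sl : size (levels s) = M.+1 by rewrite size_map /= sM.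
have [|y yl ymax] := seq_max_int (l := levels s); first by rewrite -size_eq0 sl.
have sumle (l : seq int) : {subset l <= levels s} -> \sum_(x <- l) x <= (size l)%:Z * y.
  elim: l => [|x l IH] sub; first by rewrite big_nil mul0r.
  rewrite big_cons /= intS mulrDl mul1r lerD//.
    by apply: ymax; apply: sub; exact: mem_head.
  by apply: IH => z zl; apply: sub; rewrite in_cons zl orbT.
have y0 : 0 <= y.
  have := sumle _ (fun _ => id); rewrite sum0 sl; nia.
have vle v : v \in levels s -> v ^+ 2 <= (M%:Z * y) ^+ 2.
  move=> vl; have := ymax v vl => vy.
  (* -v is the sum of the other M levels. *)
  have : - v <= M%:Z * y.
    have := sumle (rem v (levels s)) (fun z => @mem_rem _ _ _ z).
    rewrite size_rem// sl /=; move: sum0; rewrite (big_rem _ vl) /=.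
    by move=> /eqP; rewrite addrC addr_eq0 => /eqP ->.
  have h : y <= M%:Z * y by rewrite ler_peMl//; lia.
  move: (M%:Z * y) h => z h h'; clear - vy h h'.
  by rewrite -subr_ge0 subr_sqr mulr_ge0//; lia.
have eM : energy M s <= M.+1%:Z * (M%:Z * y) ^+ 2.
  have sumsq (l : seq int) k : (forall v, v \in l -> v ^+ 2 <= k) ->
      \sum_(v <- l) v ^+ 2 <= (size l)%:Z * k.
    elim: l => [|x l IH] lk; first by rewrite big_nil mul0r.
    rewrite big_cons /= intS mulrDl mul1r lerD//; first by rewrite lk ?mem_head.
    by apply: IH => z zl; rewrite lk// in_cons zl orbT.
  by rewrite -[in leRHS]sl; exact: sumsq.
have Ay : c' * A ^ y <= lyap A c s.
  have E0 v : 0 <= A ^ v by rewrite exprz_ge0 ?ltW.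
  have [cc c'1] := c'le.
  move: yl; rewrite /levels /= in_cons => /orP[/eqP->|].
    rewrite /lyap -[leLHS]add0r lerD ?sumr_ge0// ler_wpM2r//.
  move=> /mapP[x xb ->]; rewrite /lyap (big_rem _ xb) /=.
  rewrite -addrA -[leLHS]addr0 lerD//; first by rewrite ler_piMl.
  by rewrite addr_ge0 ?sumr_ge0 ?mulr_ge0// ltW.
have [n yn] : exists n : nat, y = n%:Z by clear - y0; exists `|y|%N; lia.
rewrite yn in eM Ay; have sqn := sq n.
apply: le_trans (_ : (M.+1%:R * (M ^ 2)%:R / (a ^+ 2 * c')) * (c' * A ^ n%:Z) <= _); last first.
  by rewrite ler_wpM2l.
have -> : M.+1%:R * (M ^ 2)%:R / (a ^+ 2 * c') * (c' * A ^ n%:Z) =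
   M.+1%:R * (M ^ 2)%:R * (A ^+ n / a ^+ 2).
  by rewrite -exprnP; field; rewrite !gt_eqF.
apply: le_trans (_ : M.+1%:R * (M ^ 2)%:R * n%:R ^+ 2 <= _); last first.
  by rewrite ler_wpM2l ?mulr_ge0// ler_pdivlMr ?exprn_gt0// -exprMn.
have : (energy M s)%:~R <= (M.+1%:Z * (M%:Z * n%:Z) ^+ 2)%:~R :> R by rewrite ler_int.
move=> /le_trans -> //; rewrite le_eqVlt; apply/orP; left; apply/eqP.
by rewrite rmorphM rmorphXn rmorphM /= natrX -!pmulrn; ring.
Qed.

End lyapunov.

(** * The path that always swaps *)

Section greedy.
Variables (R : realType) (M q : nat).
Hypotheses (hM : (1 <= M)%N) (hq : (2 <= q)%N).
Implicit Types (s : state) (b : seq int) (d T : int) (t : nat) (f g : state -> R).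
Local Notation trans := (@trans R M q).
Local Notation succ := (@succ R M q).
Local Notation reach := (@reach R M q).
Local Notation round := (@round R M q).
Local Notation lev := (lev M).
Local Notation energy := (energy M).
Local Notation col := (col M).

(* [step] lists the swap first, so this is the path that always swaps. *)
Definition greedy s : state := head s (succ s).

Lemma succ_greedy s : succ s = greedy s :: behead (succ s).
Proof.
by case: s => [[[b d] T] t]; rewrite /greedy succE; do ?case: ifP.
Qed.

Lemma reach_greedy n s : reach n s (iter n greedy s).
Proof.
elim: n s => [//|n IH] s; exists (greedy s); last by rewrite iterSr.
by rewrite succ_greedy mem_head.
Qed.

(** The greedy transition has probability 1 or (q - 1) / q >= 1/2. *)
Lemma trans_greedy f s : (forall x, 0 <= f x) -> f (greedy s) / 2 <= trans f s.
Proof.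
move=> f0; have q0 : (0 : R) < q%:R by rewrite ltr0n; apply: leq_trans hq.
have q2 : (2 : R) <= q%:R by rewrite ler_nat.
have q01 : 0 <= (q%:R : R)^-1 <= 1/2.
  by rewrite invr_ge0 ltW//= mul1r lef_pV2// posrE.
have half x : f x / 2 <= f x by have := f0 x; lra.
case: s => [[[b d] T] t]; rewrite transE /greedy succE mulrBl mulfV ?gt_eqF// div1r.
have [tM|tM] := leqP t M; last by case: ifP => _ /=.
case: ifP => _ //=.
set x := (set_nth _ _ _ _, _, _, _); set z := (b, d, T, t.+1).
have : 0 <= q%:R^-1 * f z by rewrite mulr_ge0//; lra.
have : q%:R^-1 * f x <= 1/2 * f x by rewrite ler_wpM2r//; lra.
lra.
Qed.

Lemma iter_trans_greedy n f s : (forall x, 0 <= f x) ->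
  f (iter n greedy s) / 2 ^+ n <= iter n trans f s.
Proof.
move=> f0; elim: n s => [|n IH] s; first by rewrite divr1.
have pos x : 0 <= iter n trans f x.
  by apply: le_trans (IH x); rewrite divr_ge0// exprn_ge0.
apply: le_trans (trans_greedy s pos).
rewrite iterSr exprS; set a := f _.
have -> : a / (2 * 2 ^+ n) = a / 2 ^+ n / 2 by field; rewrite expf_neq0.
by rewrite ler_wpM2r ?invr_ge0//; exact: IH.
Qed.

Definition top s := all (fun x => x <= sd s) (sb s).

(** Invariant: d dominates the batteries already visited, those of index below t - 1. *)
Lemma greedy_sweep n s : size (sb s) = M -> (1 <= st s)%N ->
  (st s + n = M.+1)%N ->
  (forall i, (i < (st s).-1)%N -> nth 0 (sb s) i <= sd s) ->
  top (iter n greedy s).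
Proof.
elim: n s => [|n IH] s sM t1 tn low.
  by apply/(all_nthP 0) => i; rewrite sM => iM /=; apply: low; lia.
rewrite iterSr; apply: IH.
all: case: s sM t1 tn low => [[[b d] T] t]; rewrite /sb /sd /st /= => sM t1 tn low.
all: rewrite /greedy succE (_ : (t <= M)%N = true); last lia.
all: case: ltP => dlt; rewrite /= ?size_set_nth //; try lia.
  move=> i it; rewrite nth_set_nth /=; case: eqP => [_|/eqP ne]; first exact: ltW.
  by apply: le_trans (ltW dlt); apply: low; lia.
move=> i it; have [->//|ne] := eqVneq i t.-1.
by apply: low; lia.
Qed.

Definition ground s : state := iter M.+1 greedy s.

Lemma ground_facts s : col s ->
  [/\ col (ground s), top (ground s), sT (ground s) = sT (kick M s) &
   energy (ground s) =
     energy s - 2 * M.+1%:Z * lev (sT s) (sd s) + M%:Z * M.+1%:Z].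
Proof.
move=> cs; have rs := reach_greedy M.+1 s.
have [cg Tg _ _ _] := reach_round hM hq cs rs.
split => //; last exact: energy_round cs rs.
rewrite /ground iterSr.
have -> : greedy s = kick M s by rewrite /greedy succ_kick.
have [Ss _] := andP cs.
apply: greedy_sweep; rewrite ?/kick; case: ifP => _ //; rewrite /sb /= ?size_map; 
  try exact: sb_size Ss; by rewrite /st /= add1n.
Qed.

(** 0 = d + T + sum of the b_m <= (M+1) d + M, and d is an integer. *)
Lemma top_sd_ge0 s : col s -> top s -> 0 <= sd s.
Proof.
case: s => [[[b d] T] t]; rewrite colE inSE /top /sb /sd /= => /andP[/and5P[/eqP sM _ _ /eqP sum /andP[T0 TM]] _] tp.
have : \sum_(x <- b) x <= (size b)%:Z * d.
  elim: b tp {sM sum} => [|x b IH] /=; first by rewrite big_nil mul0r.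
  by case/andP => xd /IH le; rewrite big_cons intS mulrDl mul1r lerD.
rewrite sM -(lerD2l (d + T)) sum => le.
by nia.
Qed.

(** Start of a period; [s0] is of this kind. *)
Definition base s := col s && (sT s == 0).

(** The round begun at T = j changes the energy by -2 (M+1) ((M+1) d + j) + M (M+1). From the second
    round on d >= 0, and its term is dropped; the constants add up to the last summand, which
    vanishes at k = M. *)
Lemma greedy_rounds s k : base s -> (k <= M)%N ->
  [/\ col (iter k.+1 ground s), top (iter k.+1 ground s),
     sT (iter k.+1 ground s) = (if (k < M)%N then k.+1%:Z else 0) &
     energy (iter k.+1 ground s) <= energy s - 2 * M.+1%:Z * (M.+1%:Z * sd s)
        + M.+1%:Z * (k.+1%:Z * M%:Z - k.+1%:Z * k%:Z)].
Proof.
move=> /andP[cs /eqP T0]; elim: k => [|k IH] kM.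
  have [c t T e] := ground_facts cs.
  split => //=; first by rewrite T /kick T0; case: ifP; rewrite /sT /=; case: ifP; lia.
  by rewrite e /lev T0; lia.
have [c t T e] := IH (ltnW kM).
have [c' t' T' e'] := ground_facts c.
rewrite iterS; split => //.
  by rewrite T' /kick T kM; case: ifP; rewrite /sT /=; case: ifP; lia.
rewrite e' /lev T kM; have := top_sd_ge0 c t.
move: (sd (iter _ _ _)) e => x e x0.
have : 0 <= M.+1%:Z * M.+1%:Z * x by rewrite !mulr_ge0.
by move: e; rewrite [k.+2%:Z]intS; lia.
Qed.

Definition gperiod s : state := iter M.+1 ground s.

Lemma gperiod_facts s : base s ->
  [/\ base (gperiod s), top (gperiod s) &
     energy (gperiod s) <= energy s - 2 * M.+1%:Z * (M.+1%:Z * sd s)].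
Proof.
move=> bs; have [c t T e] := greedy_rounds bs (leqnn M).
rewrite ltnn in T; split => //; first by rewrite /base c T eqxx.
by rewrite subrr mulr0 addr0 in e.
Qed.

Lemma energy_ge0 s : 0 <= energy s.
Proof. by apply: sumr_ge0 => x _; exact: sqr_ge0. Qed.

Lemma base_s0 : base (s0 M).
Proof.
rewrite /base /col /inS /inSbar /s0 /sT /sb /sd /st /= size_nseq !eqxx ltnSn /=.
by rewrite big1_seq ?addr0// => x /andP[_ /nseqP[]].
Qed.

Lemma base_flat s : base s -> all (fun x => x == 0) (sb s) -> sd s = 0 -> s = s0 M.
Proof.
case: s => [[[b d] T] t]; rewrite /base /col inSE /sb /sd /sT /st /=.
move=> /andP[/andP[/and5P[/eqP sM _ _ _ _] /eqP->] /eqP->] /all_pred1P bz ->.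
by rewrite /s0 bz sM.
Qed.

Lemma energy_le0 s : base s -> energy s <= 0 -> s = s0 M.
Proof.
move=> bs e0; have /andP[_ /eqP T0] := bs.
have z x : x \in sd s :: sb s -> x = 0.
  move=> xs; have : lev 0 x ^+ 2 <= energy s.
    rewrite /energy (big_rem (lev 0 x)) /=; last by rewrite -T0; apply: map_f.
    by rewrite lerDl; apply: sumr_ge0 => y _; exact: sqr_ge0.
  move=> /le_trans/(_ e0) le; have : lev 0 x ^+ 2 = 0 by apply/eqP; rewrite eq_le le sqr_ge0.
  by move/eqP; rewrite sqrf_eq0 /lev => /eqP; nia.
apply: base_flat => //; last by apply: z; exact: mem_head.
by apply/allP => x xs; apply/eqP; apply: z; rewrite in_cons xs orbT.
Qed.

Lemma energy_s0 : energy (s0 M) = 0.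
Proof.
rewrite /energy big_map big1_seq// => x /andP[_]; rewrite /s0 /sd /sb /sT /= in_cons.
by move=> /orP[/eqP->|/nseqP[-> _]]; rewrite /lev mulr0 addr0 expr0n.
Qed.

(** Here d = 0 is the maximum, so the batteries are nonpositive with sum 0. Away from [s0] a state
    with d on top therefore has d >= 1. *)
Lemma top_sd0 s : base s -> top s -> sd s <= 0 -> s = s0 M.
Proof.
move=> bs ts d0; have /andP[cs /eqP T0] := bs.
have d00 : sd s = 0 by apply: le_anti; rewrite d0 top_sd_ge0.
apply: base_flat => //.
have [Ss _] := andP cs; move: ts; rewrite /top d00 => neg.
have : sd s + sT s + \sum_(x <- sb s) x = 0.
  by move: Ss; rewrite /inS /inSbar => /andP[/and4P[_ _ _ /eqP]].
rewrite d00 T0 !add0r.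
elim: (sb s) neg => [//|x b IH] /= /andP[x0 neg]; rewrite big_cons => sum.
have bneg : \sum_(y <- b) y <= 0.
  rewrite big_seq; apply: sumr_le0 => y yb; exact: (allP neg).
have x00 : x = 0.
  by apply: le_anti; rewrite x0 -sum gerDl.
by rewrite x00 eqxx /=; apply: IH => //; rewrite x00 add0r in sum.
Qed.

(** The energy is a natural number that drops in each greedy period until it is 0; once reached,
    [s0] is kept. *)
Lemma gperiods_s0 n s : base s -> top s -> energy s <= n%:Z ->
  iter n gperiod s = s0 M.
Proof.
elim: n s => [|n IH] s bs ts en; first exact: energy_le0.
rewrite iterSr; have [b' t' e'] := gperiod_facts bs.
apply: IH => //; apply: le_trans e' _.
have [d0|d1] := leP (sd s) 0.
  have sE := top_sd0 bs ts d0; rewrite sE energy_s0.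
  by rewrite /s0 /sd /= !mulr0 subr0.
by nia.
Qed.

(** The first period brings d to the top. Its energy increment -2 (M+1) L, with L = (M+1) d, is at
    most (M+1)^2 + L^2, and L^2 is at most the initial energy. *)
Lemma gperiods_reset n s : base s ->
  2 * energy s + M.+1%:Z ^+ 2 <= n%:Z -> iter n.+1 gperiod s = s0 M.
Proof.
move=> bs en; rewrite iterSr; have [b' t' e'] := gperiod_facts bs.
apply: gperiods_s0 => //; apply: le_trans en; apply: le_trans e' _.
have /andP[_ /eqP T0] := bs.
have : (M.+1%:Z * sd s) ^+ 2 <= energy s.
  rewrite /energy big_cons T0 /lev addr0 lerDl.
  by apply: sumr_ge0 => y _; exact: sqr_ge0.
have : 0 <= (M.+1%:Z * sd s + M.+1%:Z) ^+ 2 by exact: sqr_ge0.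
rewrite sqrrD; lia.
Qed.

Definition period f : state -> R := iter M.+1 round f.

Lemma iter_period n f : iter n period f = iter (n * (M.+1 * M.+1)) trans f.
Proof.
by rewrite iterM; apply: eq_iter => g; rewrite iterM.
Qed.

(** As greedy periods fix [s0], all states of energy at most [r] sit there at one common time, each
    with probability at least 2^-k after [k] transitions. *)
Lemma minorization (r : int) : exists n (eps : R), [/\ (0 < n)%N, 0 < eps &
  forall s, base s -> energy s <= r ->
    eps <= iter n period (fun x => (x == s0 M)%:R) s].
Proof.
pose n := absz (2 * r + M.+1%:Z ^+ 2).
pose k := (n.+1 * (M.+1 * M.+1))%N.
exists n.+1, (1 / 2 ^+ k); split; [by []|by rewrite div1r invr_gt0 exprn_gt0|].
move=> s bs er; rewrite iter_period.
have reset : iter k greedy s = s0 M.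
  have -> : iter k greedy s = iter n.+1 gperiod s.
    rewrite /k iterM; apply: eq_iter => x; rewrite iterM; exact: eq_iter.
  by rewrite gperiods_reset// /n; lia.
pose f (x : state) : R := (x == s0 M)%:R.
have f0 x : 0 <= f x by rewrite /f ler0n.
by have := iter_trans_greedy k s f0; rewrite reset {1}/f eqxx.
Qed.

End greedy.

(** * Upper limits along a residue class *)

Section limsup.
Local Open Scope classical_set_scope.
Variable R : realType.

(** Zero terms do not raise the upper limit because l >= 0, and the residue class meets every
    tail. *)
Lemma limn_esup_residue (a : R^nat) (N r : nat) (l : R) : (0 < N)%N ->
  (forall t, 0 <= a t) ->
  (forall t, a t != 0 -> exists n, t = (n * N + r)%N) ->
  (fun n => a (n * N + r)%N) @ \oo --> l ->
  limn_esup (fun t => (a t)%:E) = l%:E.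
Proof.
move=> N0 a0 res al; have l0 : 0 <= l.
  apply: (ler_cvg_to (cvg_cst 0) al); exact: nearW.
rewrite /limn_esup limf_esupE; apply/eqP; rewrite eq_le; apply/andP; split.
  apply/lee_addgt0Pr => e e0.
  have /cvgrPdist_le /(_ e e0) [n0 _ Hn0] := al.
  apply: ereal_inf_le; exists (ereal_sup [set (a t)%:E | t in [set t | (n0 * N + r <= t)%N]]).
    by exists [set t | (n0 * N + r <= t)%N] => //; exists (n0 * N + r)%N.
  apply: ge_ereal_sup => _ [t /= tn <-]; rewrite -EFinD lee_fin.
  have [->|/res[n tE]] := eqVneq (a t) 0; first by rewrite addr_ge0// ltW.
  rewrite tE in tn *; have nn : (n0 <= n)%N by move: tn; rewrite leq_add2r leq_pmul2r.
  by have := Hn0 n nn; rewrite /= distrC ler_norml; lra.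
apply: le_ereal_inf_tmp => _ [V [n0 _ Vn0] <-].
apply/lee_subgt0Pr => e e0.
have /cvgrPdist_le /(_ e e0) [n1 _ Hn1] := al.
have := Hn1 (maxn n0 n1) (leq_maxr _ _); rewrite /= ler_norml => H.
apply: le_trans (_ : (a (maxn n0 n1 * N + r)%N)%:E <= _)%E.
  by rewrite -EFinB lee_fin; lra.
apply: ereal_sup_ubound; exists (maxn n0 n1 * N + r)%N => //; apply: Vn0 => /=.
by apply: leq_trans (leq_maxl n0 n1) _; rewrite (leq_trans _ (leq_addr _ _))// leq_pmulr.
Qed.

End limsup.

(** * The law of the chain and its clock *)

Section law.
Local Open Scope classical_set_scope.
Variables (R : realType) (M q : nat).
Hypotheses (hM : (1 <= M)%N) (hq : (2 <= q)%N).
Implicit Types (s : state) (f g : state -> R).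
Local Notation trans := (@trans R M q).

Definition dirac s : state -> R := fun x => (x == s)%:R.

Lemma dirac_ge0 s x : 0 <= dirac s x. Proof. exact: ler0n. Qed.

Lemma iter_trans_ge0 n f x : (forall y, 0 <= f y) -> 0 <= iter n trans f x.
Proof.
move=> f0; rewrite -[leLHS](mo_cst (markov_op_iter (markov_trans R hM hq) n) 0 x).
by apply: iter_trans_le => // y _.
Qed.

Lemma p_trans s s' : p R M q s s' = trans (dirac s') s.
Proof.
rewrite /p /dirac big_mkcond; apply: eq_bigr => x _.
by case: eqP => _; rewrite ?mulr1 ?mulr0.
Qed.

(** Induction splits off the first transition; its finite sum commutes with the infinite one because
    all terms are nonnegative. *)
Lemma esum_law n x g : inS M x -> (forall y, 0 <= g y) ->
  (\esum_(s in S_set M) (iter n trans (dirac s) x * g s)%:E)%E = (iter n trans g x)%:E.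
Proof.
elim: n x g => [|n IH] x g Sx g0.
  rewrite (esumID [set x]) => [|s _]; last by rewrite lee_fin mulr_ge0// dirac_ge0.
  have -> : S_set M `&` [set x] = [set x].
    by apply/seteqP; split => [y []//|y ->]; split.
  rewrite esum_set1 /= ?lee_fin ?mulr_ge0 ?dirac_ge0//.
  rewrite esum1 ?adde0 /dirac ?eqxx ?mul1r// => s [_ /= sx].
  by rewrite (_ : (x == s) = false) ?mul0r//; apply/eqP => xs; exact: sx.
(* Filtering by [P] changes no sum over [step] and carries the sign and membership conditions into
   the big operators. *)
pose P (y : state * R) := (0 <= y.2) && inS M y.1.
have stepP y : y \in step R M q x -> P y.
  move=> ys; apply/andP; split; first by have [/allP/(_ y ys)] := step_weight R M hq x.
  by apply: (succ_inS hM hq Sx); exact: map_f.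
have E f : trans f x = \sum_(y <- step R M q x | P y) y.2 * f y.1.
  rewrite /trans big_seq [RHS]big_seq_cond; apply: eq_bigl => y.
  by case ys: (y \in _) => //=; rewrite stepP.
rewrite iterS E -sumEFin.
transitivity (\sum_(y <- step R M q x | P y)
    \esum_(s in S_set M) (iter n trans (dirac s) y.1 * (y.2 * g s))%:E)%E.
  rewrite -esum_sum => [|s y _ /andP[y0 _]]; last first.
    by rewrite lee_fin !mulr_ge0// iter_trans_ge0// => z; exact: dirac_ge0.
  apply: eq_esum => s _; rewrite sumEFin iterS E mulr_suml; congr EFin.
  by apply: eq_bigr => y _; ring.
apply: eq_bigr => y /andP[y0 Sy].
rewrite (IH _ (fun s => y.2 * g s)) => // [|z]; last exact: mulr_ge0.
have T := mo_affine (markov_op_iter (markov_trans R hM hq) n).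
have -> : (fun s => y.2 * g s) = (fun s => y.2 * g s + 0) by apply/funext => z; rewrite addr0.
by rewrite T addr0.
Qed.

Lemma s0_inS : inS M (s0 M).
Proof. by have /andP[/andP[]] := base_s0 M. Qed.

(** The recursion for [mu] appends a last transition, so [esum_law] is used with g the probability
    of moving to [s]. *)
Lemma mu_law n s : mu R M q n s = (iter n trans (dirac s) (s0 M))%:E.
Proof.
elim: n s => [|n IH] s; first by rewrite /= /dirac eq_sym; case: eqP.
rewrite iterSr -(esum_law n s0_inS (g := trans (dirac s))) /=.
  by apply: eq_esum => x _; rewrite IH p_trans.
by move=> y; exact: (iter_trans_ge0 1 y (dirac_ge0 s)).
Qed.

(** The clock starts at M+1 and is then congruent to (k+1)(M+1). Readings lie between 1 and (M+1)^2,
    so the congruence is an equality, which determines T and t. *)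
Lemma reach_col n k x s : base M x ->
  reach R M q (n * (M.+1 * M.+1) + k * M.+1) x s ->
  (k <= M)%N -> col M s /\ sT s = k%:Z.
Proof.
move=> /andP[/andP[Sx /eqP tx] /eqP Tx] rs kM; have Ss := reach_inS hM hq Sx rs.
have := reach_phase hM hq Sx rs.
have -> : phase M x = M.+1 by rewrite /phase tx Tx.
rewrite addnCA modnMDl -mulSn.
move: Ss; case: s rs => [[[b d] T] t] _; rewrite /col inSE /phase /sT /st /=.
move=> Ss; move/and5P: (Ss) => [_ t1 tM _ /andP[T0 TM]] E.
have {T0 TM} [j Tj jM] : exists2 j, T = j%:Z & (j <= M)%N by exists `|T|%N; lia.
rewrite Tj /= in E.
have : (j * M.+1 + t = k.+1 * M.+1)%N.
  have lej : (j * M.+1 + t <= M.+1 * M.+1)%N.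
    by apply: leq_trans (_ : (M * M.+1 + M.+1 <= _)%N); [rewrite leq_add// leq_mul2r jM orbT|rewrite mulSn addnC].
  have lek : (k.+1 * M.+1 <= M.+1 * M.+1)%N by rewrite leq_mul2r ltnS kM orbT.
  have pos : (0 < j * M.+1 + t)%N by rewrite addn_gt0 t1 orbT.
  have posk : (0 < k.+1 * M.+1)%N by [].
  move: lej lek pos posk E; move: (M.+1 * M.+1)%N (j * M.+1 + t)%N (k.+1 * M.+1)%N => N a c aN cN a0 c0.
  case: (ltngtP a N) aN => // [aN|aN] _; case: (ltngtP c N) cN => // [cN|cN] _;
    rewrite ?aN ?cN ?modnn ?(modn_small aN) ?(modn_small cN) //; lia.
move=> H; have jk : j = k.
  by case: (ltngtP j k) => // h; have := leq_mul h (leqnn M.+1); move: H t1 tM; lia.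
have tk : t = M.+1 by move: H; rewrite jk mulSn; lia.
split; last by rewrite Tj jk.
by apply/andP; split; [exact: Ss|apply/eqP].
Qed.

Lemma reach_time n k s : reach R M q n (s0 M) s -> col M s -> sT s = k%:Z -> (k <= M)%N ->
  exists m, n = (m * (M.+1 * M.+1) + k * M.+1)%N.
Proof.
move=> rs /andP[Ss /eqP ts] Ts kM.
have := reach_phase hM hq s0_inS rs.
have -> : phase M (s0 M) = M.+1 by [].
rewrite /phase Ts ts /= addnC => /eqP; rewrite eqn_modDl => /eqP E.
exists (n %/ (M.+1 * M.+1))%N; rewrite {1}(divn_eq n (M.+1 * M.+1)) -E modn_small//.
by rewrite ltn_pmul2r.
Qed.

End law.

(** * Limits of expectations *)

Section limit_expectation.
Local Open Scope classical_set_scope.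
Variables (R : realType) (M q : nat).
Hypotheses (hM : (1 <= M)%N) (hq : (2 <= q)%N).
Implicit Types (s : state) (f g : state -> R).
Local Notation trans := (@trans R M q).
Local Notation round := (@round R M q).
Local Notation period := (@period R M q).
Local Notation en := (fun s : state => (energy M s)%:~R : R).

(** The test functions: this growth admits indicators, d and the energy itself. *)
Definition tame f := exists C : R, forall s, col M s -> `|f s| <= C * (1 + en s).

(** Expectation in period [n] at the end of the round with T = k; as [s0] has t = M+1, the offset is
    k full rounds. *)
Definition expect n k f : R := iter (n * (M.+1 * M.+1) + k * M.+1) trans f (s0 M).

Definition lexpect k f : R := limn (fun n => expect n k f).

Lemma mo_abs (J : state -> Prop) P f g x : markov_op J P ->
  (forall y, J y -> `|f y| <= g y) -> J x -> `|P f x| <= P g x.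
Proof.
move=> PJ fg Jx; rewrite ler_norml -mulN1r -[-1 * _]addr0 -(mo_affine PJ).
apply/andP; split; apply: (mo_le PJ) => // y /fg; rewrite ler_norml => /andP[//].
by rewrite mulN1r addr0.
Qed.

(** Harris' theorem for the operator of a whole period on [base], applied to the function obtained
    from [f] by [k] rounds. *)
Lemma tame_cvg k f : tame f -> (fun n => expect n k f) @ \oo --> lexpect k f.
Proof.
move=> [C fC].
have [A [c [gam [K [A1 c0 g0 [g1 K0 drift]]]]]] := lyap_drift R hM hq.
have [C1 C10 enV] := energy_lyap hM hq A1 c0.
pose V := lyap M A c.
have A0 : 0 < A by lra.
have V0 s : 0 <= V s by exact: lyap_ge0.
have K'0 : 0 <= K / (1 - gam) by rewrite divr_ge0// subr_ge0 ltW.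
have mR := markov_round R hM hq.
have dk j s : col M s -> iter j round V s <= V s + K / (1 - gam).
  move=> cs; have H := drift_iter mR j g0 g1 K0 drift cs.
  apply: le_trans H _.
  by rewrite lerD2r ler_piMl// exprn_ile1// ltW.
have mP : markov_op (base M) period.
  split.
  - exact: mo_lin (markov_op_iter mR _).
  - exact: mo_cst (markov_op_iter mR _).
  - move=> u v uv s bs; have pE h : period h = iter (M.+1 * M.+1) trans h.
      by have := iter_period M q 1 h; rewrite mul1n.
    rewrite !pE.
    apply: iter_trans_le => // s' rs; apply: uv.
    rewrite -[(M.+1 * M.+1)%N]addn0 -[X in (X + 0)%N]mul1n -[X in (_ + X)%N](mul0n M.+1) in rs.
    by have [cs' Ts'] := reach_col hM hq bs rs isT; rewrite /base cs' Ts' eqxx.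
have mid j : (fun n => expect n j f) = (fun n => iter n period (iter j round f) (s0 M)).
  by apply/funext => n; rewrite /expect iterD iter_period// (iterM j M.+1).
rewrite /lexpect mid; apply: (harris_cvg (V := V) (z := s0 M) mP g0 g1 K'0) => //.
- move=> s /andP[cs _]; apply: le_trans (drift_iter mR M.+1 g0 g1 K0 drift cs) _.
  by rewrite lerD2r ler_wpM2r// exprS ler_piMr// exprn_ile1// ltW.
(* A sublevel of [V] lies in a sublevel of the energy. *)
- move=> r; have [n [eps [n0 e0 H]]] := minorization R hM hq (Num.bound (C1 * `|r|))%:Z.
  exists n, eps; split => // s bs Vr; apply: H => //.
  rewrite -(ler_int R); have /andP[/andP[Ss _] _] := bs.
  apply: le_trans (enV s Ss) _; apply: le_trans (_ : C1 * `|r| <= _).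
    by rewrite ler_wpM2l// (le_trans Vr)// ler_norm.
  by rewrite ltW//; apply: archi_boundP; rewrite mulr_ge0.
- exact: base_s0.
- exists (`|C| * (1 + C1) * (1 + K / (1 - gam))) => s /andP[cs _].
  have mk := markov_op_iter mR k.
  apply: le_trans (mo_abs (g := fun y => `|C| * C1 * V y + `|C|) mk _ cs) _.
    move=> y cy; have /andP[Sy _] := cy; apply: le_trans (fC y cy) _.
    apply: le_trans (_ : `|C| * (1 + en y) <= _).
      by rewrite ler_wpM2r ?ler_norm// addr_ge0// ler0z energy_ge0.
    have := ler_wpM2l (normr_ge0 C) (enV y Sy); rewrite -/(V y); lra.
  rewrite (mo_affine mk); have := dk k s cs; move: (iter k round V s) => W WV.
  have CC1 : 0 <= `|C| * C1 by rewrite mulr_ge0.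
  have := ler_wpM2l CC1 WV; set K' := K / _ in K'0 *; clearbody K'.
  have Vs0 := V0 s; have : 0 <= `|C| * V s by apply: mulr_ge0.
  have : 0 <= `|C| * C1 * (K' * V s) by rewrite !mulr_ge0 ?V0.
  have : 0 <= `|C| * (K' * V s) by rewrite !mulr_ge0 ?V0.
  have : 0 <= `|C| * K' by rewrite !mulr_ge0.
  lra.
Qed.

Lemma expect_lin n k a f g :
  expect n k (fun s => a * f s + g s) = a * expect n k f + expect n k g.
Proof. exact: mo_lin (markov_op_iter (markov_trans R hM hq) _) _ _ _ _. Qed.

Lemma expect_cst n k c : expect n k (fun=> c) = c.
Proof. exact: mo_cst (markov_op_iter (markov_trans R hM hq) _) _ _. Qed.

Lemma expect_le n k f g : (k <= M)%N ->
  (forall s, col M s -> sT s = k%:Z -> f s <= g s) -> expect n k f <= expect n k g.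
Proof.
move=> kM fg; apply: iter_trans_le => // s rs.
by have [] := reach_col hM hq (base_s0 M) rs kM; exact: fg.
Qed.

Lemma tame_lin a f g : tame f -> tame g -> tame (fun s => a * f s + g s).
Proof.
move=> [C fC] [D gD]; exists (`|a| * C + D) => s cs.
apply: le_trans (ler_normD _ _) _; rewrite normrM mulrDl -mulrA.
by rewrite lerD ?gD// ler_wpM2l// fC.
Qed.

Lemma tame_le f g : tame g -> (forall s, col M s -> `|f s| <= `|g s|) -> tame f.
Proof. by move=> [C gC] fg; exists C => s cs; apply: le_trans (fg s cs) (gC s cs). Qed.

Lemma en_ge0 s : 0 <= en s. Proof. by rewrite ler0z energy_ge0. Qed.

Lemma tame_en : tame en.
Proof. by exists 1 => s _; rewrite mul1r ger0_norm ?en_ge0// lerDr. Qed.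

Lemma tame_cst c : tame (fun=> c).
Proof. by exists `|c| => s _; rewrite ler_peMr// lerDl en_ge0. Qed.

Lemma tame_dirac s : tame (dirac R s).
Proof.
apply: tame_le (tame_cst 1) _ => x _; rewrite normr1 ger0_norm ?dirac_ge0//.
by rewrite /dirac; case: eqP.
Qed.

Lemma lexpect_lin k a f g : tame f -> tame g ->
  lexpect k (fun s => a * f s + g s) = a * lexpect k f + lexpect k g.
Proof.
move=> tf tg; apply/cvg_lim => //.
rewrite (_ : (fun n => _) = (fun n => a * expect n k f + expect n k g)); last first.
  by apply/funext => n; exact: expect_lin.
apply: cvgD; last exact: tame_cvg.
by apply: cvgMl_tmp; exact: tame_cvg.
Qed.

Lemma lexpect_cst k c : lexpect k (fun=> c) = c.
Proof.
apply/cvg_lim => //; rewrite (_ : (fun n => _) = fun=> c); first exact: cvg_cst.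
by apply/funext => n; exact: expect_cst.
Qed.

Lemma lexpect_le k f g : (k <= M)%N -> tame f -> tame g ->
  (forall s, col M s -> sT s = k%:Z -> f s <= g s) -> lexpect k f <= lexpect k g.
Proof.
move=> kM tf tg fg; apply: (ler_cvg_to (tame_cvg (k := k) tf) (tame_cvg (k := k) tg)).
by apply: nearW => n; exact: expect_le.
Qed.

Lemma lexpect_sum k (l : seq state) g :
  lexpect k (fun y => \sum_(x <- l) g x * dirac R x y) =
    \sum_(x <- l) g x * lexpect k (dirac R x)
  /\ tame (fun y => \sum_(x <- l) g x * dirac R x y).
Proof.
elim: l => [|x l [IH tl]].
  have -> : (fun y => \sum_(x <- [::]) g x * dirac R x y) = fun=> 0.
    by apply/funext => y; rewrite big_nil.
  by rewrite big_nil lexpect_cst; split => //; exact: tame_cst.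
have -> : (fun y => \sum_(x <- x :: l) g x * dirac R x y) =
    fun y => g x * dirac R x y + \sum_(x <- l) g x * dirac R x y.
  by apply/funext => y; rewrite big_cons.
rewrite big_cons lexpect_lin ?IH; [|exact: tame_dirac|by []].
by split => //; apply: tame_lin => //; exact: tame_dirac.
Qed.

Lemma sum_dirac (l : seq state) g y : uniq l ->
  \sum_(x <- l) g x * dirac R x y = if y \in l then g y else 0.
Proof.
elim: l => [|x l IH] /=; first by rewrite big_nil.
move=> /andP[xl /IH E]; rewrite big_cons E in_cons /dirac.
have [->|yx] /= := eqVneq y x; last by rewrite mulr0 add0r.
by rewrite (negbTE xl) mulr1 addr0.
Qed.

(** 0 <= T <= M gives |x| <= |lev x|, and |u| |v| <= u^2 + v^2. This controls d outside large
    boxes. *)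
Lemma sd_mul_le_energy s x : inS M s -> x \in sd s :: sb s ->
  `|sd s| * `|x| <= energy M s.
Proof.
move=> Ss xs; have [T0 TM] : 0 <= sT s /\ sT s <= M%:Z by move: Ss => /and3P[].
have levle z : `|z| <= `|lev M (sT s) z| by rewrite /lev; nia.
apply: le_trans (ler_pM (normr_ge0 _) (normr_ge0 _) (levle _) (levle _)) _.
move: xs; rewrite in_cons /energy big_cons => /orP[/eqP->|xb].
  rewrite -normrM ger0_norm -?expr2 ?sqr_ge0// lerDl.
  by apply: sumr_ge0 => v _; exact: sqr_ge0.
rewrite (big_rem (lev M (sT s) x)) /=; last exact: map_f.
rewrite addrA; apply: le_trans (_ : lev M (sT s) (sd s) ^+ 2 + lev M (sT s) x ^+ 2 <= _).
  move: (lev _ _ _) (lev _ _ _) => u v.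
  have := sqr_ge0 (`|u| - `|v|); rewrite sqrrB !real_normK ?num_real//.
  have : 0 <= `|u| * `|v| by rewrite mulr_ge0.
  lia.
by rewrite lerDl; apply: sumr_ge0 => v _; exact: sqr_ge0.
Qed.

Definition rd s : R := (sd s)%:~R.

Lemma rd_le_en s : col M s -> `|rd s| <= en s.
Proof.
move=> /andP[Ss _]; rewrite /rd -intr_norm ler_int.
apply: le_trans (sd_mul_le_energy Ss (mem_head _ _)).
nia.
Qed.

Lemma tame_rd g : (forall s, `|g s| <= `|rd s|) -> tame g.
Proof.
move=> grd; apply: tame_le tame_en _ => s cs; apply: le_trans (grd s) _.
by apply: le_trans (rd_le_en cs) _; rewrite ger0_norm// en_ge0.
Qed.

Lemma S_TtP k s : S_Tt M k%:Z M.+1 s <-> col M s /\ sT s = k%:Z.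
Proof.
rewrite /S_Tt /col /=; split; first by move=> /and3P[-> /eqP -> ->].
by move=> [/andP[-> ->] ->]; rewrite eqxx.
Qed.

(** Such a state is visited only at times congruent to k (M+1) modulo (M+1)^2, and along these the
    law converges. *)
Lemma mu_infE k s : (k <= M)%N -> S_Tt M k%:Z M.+1 s ->
  mu_inf R M q s = (lexpect k (dirac R s))%:E.
Proof.
move=> kM /S_TtP[cs Ts]; rewrite /mu_inf.
under eq_fun do rewrite mu_law//.
apply: (limn_esup_residue (N := M.+1 * M.+1) (r := k * M.+1)) => //.
- by move=> t; apply: iter_trans_ge0 => // x; exact: dirac_ge0.
- move=> t nz; apply: contrapT => noclass; move/eqP: nz; apply.
  rewrite -[RHS](mo_cst (markov_op_iter (markov_trans R hM hq) t) 0 (s0 M)).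
  have E u : reach R M q t (s0 M) u -> dirac R s u = 0.
    move=> ru; rewrite /dirac; case: eqP => // us; exfalso; apply: noclass.
    by rewrite us in ru; have [m ->] := reach_time hM hq ru cs Ts kM; exists m.
  by apply/eqP; rewrite eq_le; apply/andP; split; apply: iter_trans_le => // u /E ->.
- exact: (tame_cvg (k := k) (tame_dirac s)).
Qed.

Lemma finite_box k (r : nat) :
  finite_set [set s | S_Tt M k%:Z M.+1 s /\
    forall x, x \in sd s :: sb s -> `|x| <= r%:Z].
Proof.
pose N := (r + r)%N; pose dec (i : 'I_N.+1) : int := i%:Z - r%:Z.
pose h (u : M.-tuple 'I_N.+1 * 'I_N.+1) : state :=
  ([seq dec i | i <- u.1], dec u.2, k%:Z, M.+1).
apply: (sub_finite_set (B := h @` setT)); last first.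
  by apply: finite_image; exact: finite_finset.
move=> s [/S_TtP[/andP[Ss /eqP ts] Ts] box].
pose cod (x : int) : 'I_N.+1 := inord (absz (x + r%:Z)).
have codK x : x \in sd s :: sb s -> dec (cod x) = x.
  by move=> /box xr; rewrite /dec /cod inordK /N; lia.
have sz : size [seq cod x | x <- sb s] == M by rewrite size_map (sb_size Ss).
exists (Tuple sz, cod (sd s)) => //.
have sE : s = (sb s, sd s, sT s, st s) by case: (s) => [[[]]].
rewrite [RHS]sE.
rewrite Ts ts /h /= codK ?mem_head//; congr (_, _, _, _).
rewrite -map_comp -[RHS]map_id; apply/eq_in_map => x xb /=.
by rewrite codK// in_cons xb orbT.
Qed.

(** No mass of [g] escapes to infinity. Finite partial sums are bounded by monotonicity; conversely,
    outside a box of radius r one has g <= |d| <= energy / r, whose limit expectation is small. *)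
Lemma esum_lexpect k g : (k <= M)%N -> (forall s, 0 <= g s) ->
  (forall s, g s <= `|rd s|) ->
  (\esum_(s in S_Tt M k%:Z M.+1) (lexpect k (dirac R s) * g s)%:E)%E
    = (lexpect k g)%:E.
Proof.
move=> kM g0 grd.
have tg : tame g by apply: tame_rd => s; rewrite ger0_norm.
apply/eqP; rewrite eq_le; apply/andP; split.
  apply: ge_ereal_sup => _ [F [finF FS] <-].
  rewrite fsbig_finite// sumEFin lee_fin.
  have [E t] := lexpect_sum k (finmap.enum_fset (fset_set F)) g.
  under eq_bigr do rewrite mulrC.
  rewrite -E; apply: lexpect_le => // s _ _.
  by rewrite sum_dirac; [case: ifP|exact: finmap.fset_uniq].
apply/lee_addgt0Pr => e e0.
pose Q := lexpect k en.
have Q0 : 0 <= Q.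
  rewrite -(lexpect_cst k 0); apply: lexpect_le => //; [exact: tame_cst|exact: tame_en|].
  by move=> s _ _; exact: en_ge0.
(* The radius makes the tail Q / r at most e; the successor keeps it positive. *)
pose r := (Num.bound (Q / e)).+1.
have r0 : 0 < r%:R :> R by rewrite ltr0n.
have Qr : Q / r%:R <= e.
  rewrite ler_pdivrMr// mulrC -ler_pdivrMr// ltW//.
  apply: lt_le_trans (archi_boundP _) _; first by rewrite divr_ge0// ltW.
  by rewrite ler_nat.
pose F := [set s | S_Tt M k%:Z M.+1 s /\ forall x, x \in sd s :: sb s -> `|x| <= r%:Z].
have finF : finite_set F by exact: finite_box.
apply: le_trans (_ : ((\sum_(s <- finmap.enum_fset (fset_set F)) lexpect k (dirac R s) * g s) + e)%:E <= _)%E; last first.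
  rewrite EFinD leeD2r// -sumEFin.
  apply: esum_ge; exists F; first by split => // s [].
  by rewrite fsbig_finite.
rewrite lee_fin; under eq_bigr do rewrite mulrC.
have [E t] := lexpect_sum k (finmap.enum_fset (fset_set F)) g.
rewrite -E; apply: le_trans (_ : lexpect k (fun s => (r%:R)^-1 * en s +
   \sum_(x <- finmap.enum_fset (fset_set F)) g x * dirac R x s) <= _); last first.
  rewrite (lexpect_lin k _ tame_en t) addrC lerD2l -/Q mulrC; exact: Qr.
apply: lexpect_le => //; first by apply: tame_lin => //; exact: tame_en.
move=> s cs Ts; rewrite sum_dirac; last exact: finmap.fset_uniq.
rewrite in_fset_set//.
case: ifPn => [_|].
  by rewrite lerDr mulr_ge0 ?en_ge0// invr_ge0 ltW.
rewrite notin_setE addr0 => sF; apply: le_trans (grd s) _.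
have [x xs xr] : exists2 x, x \in sd s :: sb s & r%:Z < `|x|.
  apply: contrapT => nx; apply: sF; split; first exact/S_TtP.
  by move=> x xs; rewrite leNgt; apply/negP => xr; apply: nx; exists x.
have [Ss _] := andP cs.
rewrite mulrC ler_pdivlMr// /rd -intr_norm pmulrn -intrM ler_int.
apply: le_trans (sd_mul_le_energy Ss xs); rewrite ler_wpM2l//.
exact: ltW.
Qed.

(** The positive and negative parts of d both have finite sums, so the extended difference is a real
    one. *)
Lemma dbarE k : (k <= M)%N -> dbar R M q k%:Z M.+1 = (lexpect k rd)%:E.
Proof.
move=> kM; rewrite /dbar.
have l0 s : 0 <= lexpect k (dirac R s).
  rewrite -(lexpect_cst k 0); apply: (lexpect_le kM (tame_cst 0) (tame_dirac s)) => x _ _.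
  exact: dirac_ge0.
pose gp s := Num.max (rd s) 0; pose gn s := Num.max (- rd s) 0.
have gp_le s : `|gp s| <= `|rd s|.
  by rewrite /gp; case: (leP (rd s) 0) => _; rewrite ?normr0.
have gn_le s : `|gn s| <= `|rd s|.
  by rewrite /gn; case: (leP (- rd s) 0) => _; rewrite ?normr0 ?normrN.
have gp0 s : 0 <= gp s by rewrite /gp le_max lexx orbT.
have gn0 s : 0 <= gn s by rewrite /gn le_max lexx orbT.
rewrite [X in (X - _)%E](eq_esum (b := fun s => (lexpect k (dirac R s) * gp s)%:E)); last first.
  move=> s Ss; rewrite funeposE (mu_infE kM Ss) -EFinM -EFin_max; congr EFin.
  by rewrite /gp maxr_pMr// mulr0.
rewrite [X in (_ - X)%E](eq_esum (b := fun s => (lexpect k (dirac R s) * gn s)%:E)); last first.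
  move=> s Ss; rewrite funenegE (mu_infE kM Ss) -EFinM -EFinN -EFin_max; congr EFin.
  by rewrite /gn maxr_pMr// mulr0 mulrN.
rewrite !esum_lexpect//; try by move=> s; rewrite -[leLHS]ger0_norm.
rewrite -EFinB; congr EFin.
have -> : rd = fun s => -1 * gn s + gp s.
  by apply/funext => s; rewrite /gn /gp; case: (leP (- rd s) 0); case: (leP (rd s) 0); lra.
rewrite lexpect_lin; [ring|exact: tame_rd|exact: tame_rd].
Qed.

Lemma expect_energy n k : (k <= M)%N ->
  expect n k.+1 en = expect n k en - 2 * M.+1%:R ^+ 2 * expect n k rd
    - 2 * M.+1%:R * k%:R + M%:R * M.+1%:R.
Proof.
move=> kM.
have -> : expect n k.+1 en = expect n k (round en).
  by rewrite /expect /round -iterD -addnA [(k * _ + _)%N]addnC -mulSn.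
set c := - 2 * M.+1%:R * k%:R + M%:R * M.+1%:R : R.
pose F s : R := (- 2 * M.+1%:R ^+ 2) * rd s + (1 * en s + c).
have E s : col M s -> sT s = k%:Z -> round en s = F s.
  move=> cs Ts; pose v : R := (energy M s - 2 * M.+1%:Z * lev M (sT s) (sd s) + M%:Z * M.+1%:Z)%:~R.
  have -> : round en s = v.
    rewrite -[RHS](mo_cst (markov_op_iter (markov_trans R hM hq) M.+1) v s).
    by apply/eqP; rewrite eq_le; apply/andP; split; apply: iter_trans_le => // u ru;
      rewrite (energy_round hM hq cs ru).
  rewrite /v /F /c /rd /lev Ts !(rmorphD, rmorphM, rmorphB, rmorphN) /= -!pmulrn; ring.
have -> : expect n k (round en) = expect n k F.
  by apply/eqP; rewrite eq_le; apply/andP; split; apply: expect_le => // s cs Ts; rewrite E.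
rewrite /F expect_lin (expect_lin n k 1 en (fun=> c)) expect_cst /c; ring.
Qed.

(** Telescoping over the rounds T = 0, ..., j-1; the last summand vanishes at j = M+1. *)
Lemma sum_expect_rd n j : (j <= M.+1)%N ->
  expect n j en = expect n 0 en - 2 * M.+1%:R ^+ 2 * \sum_(0 <= k < j) expect n k rd
    + M.+1%:R * (j%:R * M%:R - j%:R * (j%:R - 1)).
Proof.
elim: j => [|j IH] jM; first by rewrite big_geq//; ring.
rewrite expect_energy// IH ?(ltnW jM)// big_nat_recr//= -(natr1 j); ring.
Qed.

(** Up to a constant factor the sum of the expected d over period n is the energy drop from period n
    to n+1, whose two terms have the same limit. *)
Lemma sum_lexpect_rd : \sum_(0 <= k < M.+1) lexpect k rd = 0.
Proof.
have trd : tame rd by exact: tame_rd.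
have c1 : (fun n => \sum_(0 <= k < M.+1) expect n k rd) @ \oo -->
    \sum_(0 <= k < M.+1) lexpect k rd.
  by apply: cvg_big => [|k _]; [exact: add_continuous|exact: tame_cvg].
have c2 : (fun n => (2 * M.+1%:R ^+ 2)^-1 * (expect n 0 en - expect n.+1 0 en)) @ \oo -->
    (2 * M.+1%:R ^+ 2)^-1 * (lexpect 0 en - lexpect 0 en).
  apply: cvgMl_tmp; apply: cvgB; first exact: (tame_cvg (k := 0) tame_en).
  rewrite (cvg_shiftS (fun n => expect n 0 en)).
  exact: (tame_cvg (k := 0) tame_en).
rewrite subrr mulr0 in c2.
suff E : (fun n => \sum_(0 <= k < M.+1) expect n k rd) = (fun n =>
    (2 * M.+1%:R ^+ 2)^-1 * (expect n 0 en - expect n.+1 0 en)).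
  by rewrite E in c1; exact: (cvg_unique _ c1 c2).
apply/funext => n.
(* After M+1 rounds of period n, period n+1 starts. *)
have -> : expect n.+1 0 en = expect n M.+1 en.
  by rewrite /expect mul0n addn0 mulSn addnC.
rewrite (sum_expect_rd n (leqnn _)) -(natr1 M); field.
by rewrite natr1 pnatr_eq0.
Qed.

End limit_expectation.

Unset Implicit Arguments.

Theorem theorem16 (R : realType) (M q : nat) (hM : (1 <= M)%N) (hq : (2 <= q)%N) :
  dbarbar R M q = 0%E.
Proof.
rewrite /dbarbar (eq_big_nat _ _ (F2 := fun k => (lexpect M q k (rd R))%:E)).
  by rewrite sumEFin sum_lexpect_rd// mule0.
by move=> k /andP[_ kM]; rewrite dbarE.
Qed.
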